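(* Let $G$ and $\tilde G$ be finite solvable groups, and let $\mathrm{can}(G)$ and $\mathrm{can}(\tilde G)$ be their canonical polycyclic presentations, constructed (with respect to a fixed canonical filtration and fixed orderings) as described in the context. Then $G\cong\tilde G$ if and only if $\mathrm{can}(G)=\mathrm{can}(\tilde G)$, where equality means that the two presentations are literally the same (same generators, same relations, as strings of symbols).
   Context: Conventions. $x^g=g^{-1}xg$. A group presentation is identified with the group it defines. $\circ$ is ordinary composition of maps. A module structure of a group $A$ on an abelian group $B$ is a homomorphism $\varepsilon\colon A\to\mathrm{Aut}(B)$, where products in $\mathrm{Aut}(B)$ are read as right actions, i.e. $\varepsilon(aa')=\varepsilon(a')\circ\varepsilon(a)$; we write $b^a=\varepsilon(a)(b)$. Polycyclic presentations. A polycyclic presentation on generators $g_1,\dots,g_n$ with relative orders $r_1,\dots,r_n$ has relations $g_k^{r_k}=w_k$ ($1\le k\le n$) and $g_j^{g_i}=w_{i,j}$ ($1\le i<j\le n$), with $w_k$ a normal-form word in $g_{k+1},\dots,g_n$ and $w_{i,j}$ a normal-form word in $g_{i+1},\dots,g_n$; a normal form is a word $g_1^{e_1}\cdots g_n^{e_n}$ with $0\le e_i<r_i$, and all presentations here are consistent, i.e. each element has exactly one normal form. Canonical filtration. A canonical filtration assigns to each finite solvable group $G$ a subnormal series $G=C_1(G)\ge C_2(G)\ge\dots\ge C_{c+1}(G)=\{1\}$, $c=c(G)$, such that $C_1(G)/C_2(G)$ is nilpotent, $C_i(G)/C_{i+1}(G)$ is elementary abelian of prime-power order for $i\ge2$,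 and, if $\tilde G\cong G$, then $c(\tilde G)=c(G)$ and every isomorphism $G\to\tilde G$ restricts to isomorphisms $C_i(G)\to C_i(\tilde G)$ for all $i$. Fix once and for all a canonical filtration for which $G/C_2(G)$ is always abelian; write $G_i=C_i(G)$. Start of the construction. For a cyclic group $A\cong C_e$ with $e=p_1\cdots p_\ell$, $p_1\ge\dots\ge p_\ell$ primes, $\mathrm{can}(A)=\langle g_1,\dots,g_\ell\mid g_i^{p_i}=g_{i+1}\ (i<\ell),\ g_\ell^{p_\ell}=1,\ g_j^{g_i}=g_j\ (i<j)\rangle$. For a finite abelian group $A$ with abelian invariants $[e_1,\dots,e_m]$ (a list uniquely determined by the isomorphism type of $A$, in a fixed convention, with $A\cong C_{e_1}\times\dots\times C_{e_m}$), $\mathrm{can}(A)$ is the polycyclic presentation on $g_1,g_2,\dots$ of the direct product of $\mathrm{can}(C_{e_1}),\dots,\mathrm{can}(C_{e_m})$ (the empty presentation if $A$ is trivial). This defines $\mathrm{can}(G/G_2)$. Iteration. Let $2\le k\le c$ and suppose $H=\mathrm{can}(G/G_k)\cong G/G_k$ has been constructed. (Here $\mathrm{can}(G/G_k)$ denotes the output of the earlier steps of this construction for $G$.) Let $|G_k/G_{k+1}|=p^m$ and $M=\langle a_1,\dots,a_m\mid a_i^p,\ a_j^{a_i}=a_j\ (i<j)\rangle$. (1) Module structure. For isomorphisms $\varphi\colon G/G_k\to H$ and $\beta\colon G_k/G_{k+1}\to M$, the induced $H$-module structure on $M$ is $\varepsilon\colon H\to\mathrm{Aut}(M)$, $\varepsilon(h)=\beta\circ\mu(\varphi^{-1}(h))\circ\beta^{-1}$,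 where $\mu\colon G/G_k\to\mathrm{Aut}(G_k/G_{k+1})$ is the conjugation action, $\mu(gG_k)(xG_{k+1})=x^gG_{k+1}$. The group $\mathrm{Aut}(H)\times\mathrm{Aut}(M)$ acts on module structures by $((u,v)\cdot\varepsilon)(h)=v\circ\varepsilon(u^{-1}(h))\circ v^{-1}$. For all $H$, $M$ a total ordering on the set of all $H$-module structures on $M$ is fixed; the canonical $H$-module structure is the minimal element of the orbit of $\varepsilon$. Replacing $\varphi,\beta$ by $u\circ\varphi,v\circ\beta$ for suitable $(u,v)\in\mathrm{Aut}(H)\times\mathrm{Aut}(M)$, one chooses $\varphi,\beta$ so that the induced structure $\varepsilon$ is the canonical one; it is then fixed. (2) Cocycle. Choose a transversal $\tau\colon G/G_k\to G/G_{k+1}$ (a section of the natural projection) with $\tau(1)=1$, put $\gamma'(a,b)=\tau(ab)^{-1}\tau(a)\tau(b)$ and $\gamma=\beta\circ\gamma'\circ(\varphi^{-1},\varphi^{-1})\colon H\times H\to M$. Let $Z^2(H,M)$ be the group of normalised 2-cocycles, i.e. maps $\gamma\colon H\times H\to M$ with $\gamma(1,h)=\gamma(h,1)=1$ and $\gamma(gh,k)\gamma(g,h)^k=\gamma(g,hk)\gamma(h,k)$, and $B^2(H,M)$ the subgroup of coboundaries $(g,h)\mapsto f(gh)^{-1}f(g)^hf(h)$ with $f\colon H\to M$, $f(1)=1$ (group operation on $Z^2$ also written additively). Let $\mathrm{CP}(H,M)=\{(\mu,\nu)\in\mathrm{Aut}(H)\times\mathrm{Aut}(M)\mid \nu(b^h)=\nu(b)^{\mu(h)}\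 \forall h\in H,b\in M\}$. For all $H$, $M$ a total ordering on the set of maps $H\times H\to M$ is fixed; let $\lambda$ be the minimal element of the finite set $\bigcup_{(\mu,\nu)\in\mathrm{CP}(H,M)}\big(\nu\circ\gamma\circ(\mu^{-1},\mu^{-1})+B^2(H,M)\big)$. (3) Presentation. For $\lambda\in Z^2(H,M)$ let $E(\lambda)=\{(g,a)\mid g\in H,a\in M\}$ with product $(g,a)(h,b)=(gh,a^hb\lambda(g,h))$. If $H$ has generators $g_1,\dots,g_n$ and relations $g_k^{r_k}=w_k$, $g_j^{g_i}=w_{i,j}$, define normal-form words $t_k,t_{i,j}$ in $a_1,\dots,a_m$ by $(g_k,1)^{r_k}=w_k((g_1,1),\dots,(g_n,1))\,(1,t_k)$ and $(g_j,1)^{(g_i,1)}=w_{i,j}((g_1,1),\dots,(g_n,1))\,(1,t_{i,j})$; the list of all $t_k,t_{i,j}$ is $\mathrm{tail}(\lambda)$. Then $E(\mathrm{tail}(\lambda))$ is the polycyclic presentation on $g_1,\dots,g_n,a_1,\dots,a_m$ (the $a_j$ renamed $g_{n+1},\dots,g_{n+m}$) with relations $g_k^{r_k}=w_kt_k$, $g_j^{g_i}=w_{i,j}t_{i,j}$ ($i<j$), $a_k^p=1$, $a_j^{a_i}=a_j$ ($i<j$), and $a_j^{g_i}=\varepsilon(g_i)(a_j)$ written in normal form. Set $\mathrm{can}(G/G_{k+1})=E(\mathrm{tail}(\lambda))$. Finally $\mathrm{can}(G)=\mathrm{can}(G/G_{c+1})$ (the empty presentation if $G$ is trivial). The construction involves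 auxiliary choices of $\varphi,\beta,\tau$; $\mathrm{can}(G)$ denotes the resulting presentation for any such choices. *)

(* Defs.v *)
Set Warnings "-notation-overridden,-redundant-canonical-projection".
From HB Require Import structures.
From mathcomp Require Import all_boot all_order all_fingroup all_solvable.
From mathcomp Require Import boolp.

Set Implicit Arguments.
Unset Strict Implicit.
Unset Printing Implicit Defensive.

Local Open Scope group_scope.

(* The generators of a presentation with n relative orders are g_0, ...,
   g_(n-1) (numbered from 0).  A word g_0^{e_0} ... g_(n-1)^{e_(n-1)} is stored
   as its exponent sequence [:: e_0; ...; e_(n-1)].  The relations are
     g_k^{r_k} = w_k          with  r_k = nth 0 pc_ord k,  w_k = nth [::] pc_pow k
     g_j^{g_i} = w_{i,j}      with  w_{i,j} = nth [::] (nth [::] pc_conj j) i,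
   for i < j; the j-th entry of pc_conj lists w_{0,j}, ..., w_{j-1,j}, so that
   nothing is stored for i >= j and equality of records is literal equality of
   the presentations. *)

Record pcp := Pcp {
  pc_ord : seq nat;
  pc_pow : seq (seq nat);
  pc_conj : seq (seq (seq nat)) }.

Definition pc_rank (P : pcp) : nat := size (pc_ord P).
Definition pc_relord (P : pcp) (k : nat) : nat := nth 0%N (pc_ord P) k.
Definition pc_pow_rhs (P : pcp) (k : nat) : seq nat := nth [::] (pc_pow P) k.
Definition pc_conj_rhs (P : pcp) (i j : nat) : seq nat :=
  nth [::] (nth [::] (pc_conj P) j) i.

(* w is a normal-form word in the generators with index > k *)
Definition nf_above (P : pcp) (k : nat) (w : seq nat) : Prop :=
  size w = pc_rank P /\
  forall l, (l < pc_rank P)%N ->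
    if (k < l)%N then (nth 0%N w l < pc_relord P l)%N else nth 0%N w l == 0%N.

Definition is_pcp (P : pcp) : Prop :=
  [/\ size (pc_pow P) = pc_rank P,
      forall k, (k < pc_rank P)%N -> nf_above P k (pc_pow_rhs P k),
      size (pc_conj P) = pc_rank P,
      forall j, (j < pc_rank P)%N -> size (nth [::] (pc_conj P) j) = j
    & forall i j, (i < j)%N -> (j < pc_rank P)%N ->
        nf_above P i (pc_conj_rhs P i j)].

(* Group words: (i, true) is the letter g_i, and (i, false) is g_i^-1. *)
Definition word (n : nat) := seq ('I_n * bool).

Definition expo_word (n : nat) (e : 'I_n -> nat) : word n :=
  flatten [seq nseq (e i) (i, true) | i <- enum 'I_n].

(* Equality of words in the group defined by P: the congruence generated by
   free cancellation and the relations of P. *)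
Inductive pc_eq (P : pcp) : word (pc_rank P) -> word (pc_rank P) -> Prop :=
| pc_eq_refl u : pc_eq u u
| pc_eq_sym u v : pc_eq u v -> pc_eq v u
| pc_eq_trans u v w : pc_eq u v -> pc_eq v w -> pc_eq u w
| pc_eq_cat u u' v v' : pc_eq u u' -> pc_eq v v' -> pc_eq (u ++ v) (u' ++ v')
| pc_eq_cancel i b : pc_eq [:: (i, b); (i, ~~ b)] [::]
| pc_eq_pow (k : 'I_(pc_rank P)) :
    pc_eq (nseq (pc_relord P k) (k, true)) (expo_word (nth 0%N (pc_pow_rhs P k)))
| pc_eq_conj (i j : 'I_(pc_rank P)) : (i < j)%N ->
    pc_eq [:: (i, false); (j, true); (i, true)]
          (expo_word (nth 0%N (pc_conj_rhs P i j))).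

Definition nform (P : pcp) := {dffun forall i : 'I_(pc_rank P), 'I_(pc_relord P i)}.

Definition nf_word (P : pcp) (e : nform P) : word (pc_rank P) :=
  expo_word (fun i => e i : nat).

Definition consistent (P : pcp) : Prop :=
  forall w : word (pc_rank P), exists! e : nform P, pc_eq w (nf_word e).

Record cpcp := CPcp {
  cpcp_val :> pcp;
  cpcp_is_pcp : is_pcp cpcp_val;
  cpcp_consistent : consistent cpcp_val }.

(* The group defined by a consistent presentation, carried by its set of normal
   forms. *)
Definition pcg (P : cpcp) : Type := nform P.

#[hnf] HB.instance Definition _ (P : cpcp) := Finite.copy (pcg P) (nform P).

Section PcGroup.
Variable P : cpcp.
Implicit Types (x y z : pcg P) (u v w : word (pc_rank P)).

Definition pc_collect w : pcg P := sval (cid (cpcp_consistent w)).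
Definition pc_word x : word (pc_rank P) := nf_word (x : nform P).
Definition pc_expo x (i : 'I_(pc_rank P)) : nat := (x : nform P) i.

Definition inv_word w : word (pc_rank P) := rev [seq (l.1, ~~ l.2) | l <- w].

Definition pcg_one : pcg P := pc_collect [::].
Definition pcg_mul x y : pcg P := pc_collect (pc_word x ++ pc_word y).
Definition pcg_inv x : pcg P := pc_collect (inv_word (pc_word x)).

Lemma pc_collectP w : pc_eq w (pc_word (pc_collect w)).
Proof. by rewrite /pc_collect; case: cid => e []. Qed.

Lemma pc_collect_eq u v : pc_eq u v -> pc_collect u = pc_collect v.
Proof.
move=> uv; have [e [_ eu]] := cpcp_consistent u.
rewrite -(eu _ (pc_collectP u)); apply: eu.
exact: pc_eq_trans uv (pc_collectP v).
Qed.

Lemma pc_wordK : cancel pc_word pc_collect.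
Proof.
move=> x; have [e [_ ex]] := cpcp_consistent (pc_word x).
rewrite -(ex _ (pc_collectP _)); apply: (ex x); exact: pc_eq_refl.
Qed.

Lemma pcg_mulE u v : pcg_mul (pc_collect u) (pc_collect v) = pc_collect (u ++ v).
Proof.
by apply/pc_collect_eq/pc_eq_sym/pc_eq_cat; apply: pc_collectP.
Qed.

Lemma pc_eq_inv_word w : pc_eq (inv_word w ++ w) [::].
Proof.
elim: w => [|[i b] w IHw]; first exact: pc_eq_refl.
rewrite /inv_word /= rev_cons cat_rcons.
apply: pc_eq_trans IHw; apply: pc_eq_cat; first exact: pc_eq_refl.
apply: (@pc_eq_cat _ [:: (i, ~~ b); (i, b)] [::] w w); last exact: pc_eq_refl.
by have := pc_eq_cancel (P := P) i (~~ b); rewrite negbK.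
Qed.

Lemma pcg_mulA : associative pcg_mul.
Proof.
move=> x y z; rewrite -(pc_wordK x) -(pc_wordK y) -(pc_wordK z).
by rewrite !pcg_mulE catA.
Qed.

Lemma pcg_mul1 : left_id pcg_one pcg_mul.
Proof. by move=> x; rewrite -(pc_wordK x) pcg_mulE. Qed.

Lemma pcg_mulV : left_inverse pcg_one pcg_inv pcg_mul.
Proof.
move=> x; rewrite /pcg_inv -{2}(pc_wordK x) pcg_mulE.
exact/pc_collect_eq/pc_eq_inv_word.
Qed.

HB.instance Definition _ :=
  Finite_isGroup.Build (pcg P) pcg_mulA pcg_mul1 pcg_mulV.

Definition pc_gen (i : 'I_(pc_rank P)) : pcg P := pc_collect [:: (i, true)].

Definition expo_seq x : seq nat := [seq pc_expo x i | i <- enum 'I_(pc_rank P)].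

End PcGroup.

Definition pcp_empty : pcp := Pcp [::] [::] [::].

(* the exponent sequence of the word g_j; for j = n it is that of the empty word *)
Definition unit_word (n j : nat) : seq nat := mkseq (fun l => nat_of_bool (l == j)) n.

Definition unit_conj (n : nat) : seq (seq (seq nat)) :=
  mkseq (fun j => nseq j (unit_word n j)) n.

(* prime factors of e with multiplicity, in non-increasing order *)
Definition prime_list (e : nat) : seq nat :=
  rev (flatten [seq nseq f.2 f.1 | f <- prime_decomp e]).

Definition can_cyclic (e : nat) : pcp :=
  let l := size (prime_list e) in
  Pcp (prime_list e) (mkseq (fun k => unit_word l k.+1) l) (unit_conj l).

Definition pcp_prod (P Q : pcp) : pcp :=
  let n := pc_rank P in let m := pc_rank Q in
  let padr w := w ++ nseq m 0%N in
  let padl w := nseq n 0%N ++ w in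
  Pcp (pc_ord P ++ pc_ord Q)
      (map padr (pc_pow P) ++ map padl (pc_pow Q))
      (map (map padr) (pc_conj P) ++
       mkseq (fun j => nseq n (unit_word (n + m) (n + j)) ++
                       map padl (nth [::] (pc_conj Q) j)) m).

Definition can_abelian (es : seq nat) : pcp :=
  foldr (fun e => pcp_prod (can_cyclic e)) pcp_empty es.

(* < a_1, ..., a_m | a_i^p, a_j^{a_i} = a_j (i < j) > *)
Definition pcp_elem (p m : nat) : pcp :=
  Pcp (nseq m p) (nseq m (nseq m 0%N)) (unit_conj m).

Record canonical_filtration := CanonicalFiltration {
  cf_len : forall gT : finGroupType, {group gT} -> nat;
  cf_term : forall gT : finGroupType, {group gT} -> nat -> {group gT};
  cf_first : forall (gT : finGroupType) (G : {group gT}),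
    solvable G -> cf_term G 1 = G;
  cf_last : forall (gT : finGroupType) (G : {group gT}),
    solvable G -> cf_term G (cf_len G).+1 = 1%G;
  cf_normal : forall (gT : finGroupType) (G : {group gT}) (i : nat),
    solvable G -> (1 <= i <= cf_len G)%N -> cf_term G i.+1 <| cf_term G i;
  cf_nilpotent : forall (gT : finGroupType) (G : {group gT}),
    solvable G -> (1 <= cf_len G)%N -> nilpotent (cf_term G 1 / cf_term G 2);
  cf_abelem : forall (gT : finGroupType) (G : {group gT}) (i : nat),
    solvable G -> (2 <= i <= cf_len G)%N ->
    exists2 p : nat, prime p & p.-abelem (cf_term G i / cf_term G i.+1);
  cf_isom : forall (gT hT : finGroupType) (G : {group gT}) (H : {group hT})
      (f : {morphism G >-> hT}),
    solvable G -> isom G H f ->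
    cf_len G = cf_len H /\
    forall i, (1 <= i <= (cf_len G).+1)%N -> f @* cf_term G i = cf_term H i }.

Definition abelian_top (C : canonical_filtration) : Prop :=
  forall (gT : finGroupType) (G : {group gT}),
    solvable G -> abelian (G / cf_term C G 2).

Record abelian_invariants := AbelianInvariants {
  ai_inv : forall gT : finGroupType, {group gT} -> seq nat;
  ai_isog : forall (gT hT : finGroupType) (A : {group gT}) (B : {group hT}),
    abelian A -> A \isog B -> ai_inv A = ai_inv B;
  ai_cyclic : forall (gT : finGroupType) (A : {group gT}),
    abelian A ->
    exists2 b : seq gT,
      \big[dprod/1]_(x <- b) <[x]> = A & [seq #[x] | x <- b] = ai_inv A }.

Record total_order_on (T : Type) (D : T -> Prop) (r : rel T) : Prop := {
  to_refl : forall x, D x -> r x x;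
  to_anti : forall x y, D x -> D y -> r x y -> r y x -> x = y;
  to_trans : forall y x z, D x -> D y -> D z -> r x y -> r y z -> r x z;
  to_total : forall x y, D x -> D y -> r x y || r y x }.

Definition is_minimum (T : Type) (r : rel T) (D : T -> Prop) (x : T) : Prop :=
  D x /\ forall y, D y -> r x y.

Section Modules.
Variables H M : finGroupType.
Implicit Types (e : {ffun H -> {perm M}}) (u : {perm H}) (v : {perm M})
  (c : {ffun H * H -> M}).

(* The product of {perm M} composes from left to right, i.e. (s * t) b = t (s b),
   so a module structure is multiplicative for it. *)
Definition is_modstr e : Prop :=
  (forall h : H, e h \in Aut [set: M]) /\ {morph e : g h / g * h}.

Definition is_aut_pair (uv : {perm H} * {perm M}) : Prop :=
  uv.1 \in Aut [set: H] /\ uv.2 \in Aut [set: M].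

(* h |-> v o e (u^-1 h) o v^-1 *)
Definition modstr_act u v e : {ffun H -> {perm M}} :=
  [ffun h => v^-1 * e (u^-1 h) * v].

Definition modstr_orbit e : {ffun H -> {perm M}} -> Prop :=
  fun e' => exists2 uv, is_aut_pair uv & e' = modstr_act uv.1 uv.2 e.

Definition is_cocycle e c : Prop :=
  (forall h : H, c (1, h) = 1 /\ c (h, 1) = 1) /\
  forall g h k : H, c (g * h, k) * e k (c (g, h)) = c (g, h * k) * c (h, k).

Definition coboundary e (f : {ffun H -> M}) : {ffun H * H -> M} :=
  [ffun gh => (f (gh.1 * gh.2))^-1 * e gh.2 (f gh.1) * f gh.2].

Definition is_coboundary e c : Prop :=
  exists2 f : {ffun H -> M}, f 1 = 1 & c = coboundary e f.

Definition compatible_pair e (uv : {perm H} * {perm M}) : Prop :=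
  is_aut_pair uv /\ forall (h : H) (b : M), uv.2 (e h b) = e (uv.1 h) (uv.2 b).

(* v o c o (u^-1, u^-1) *)
Definition cocycle_act u v c : {ffun H * H -> M} :=
  [ffun gh => v (c (u^-1 gh.1, u^-1 gh.2))].

(* the union over the compatible pairs (u, v) of v o c o (u^-1, u^-1) + B^2 *)
Definition cocycle_class e c : {ffun H * H -> M} -> Prop :=
  fun c' => exists uv : {perm H} * {perm M}, exists b : {ffun H * H -> M},
    [/\ compatible_pair e uv, is_coboundary e b
      & c' = [ffun gh => cocycle_act uv.1 uv.2 c gh * b gh]].

Record cocycle := Cocycle {
  coc_abelian : abelian [set: M];
  coc_eps : {ffun H -> {perm M}};
  coc_modstr : is_modstr coc_eps;
  coc_val : {ffun H * H -> M};
  coc_cocycle : is_cocycle coc_eps coc_val }.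

Definition ext (z : cocycle) : Type := (H * M)%type.

#[hnf] HB.instance Definition _ (z : cocycle) := Finite.copy (ext z) (H * M)%type.

Variable z : cocycle.

Definition ext_pair (g : H) (a : M) : ext z := (g, a).

Definition ext_one : ext z := ext_pair 1 1.

Definition ext_mul (x y : ext z) : ext z :=
  ext_pair (x.1 * y.1) (coc_eps z y.1 x.2 * y.2 * coc_val z (x.1, y.1)).

Definition ext_inv (x : ext z) : ext z :=
  ext_pair x.1^-1 (coc_eps z x.1^-1 (x.2 * coc_val z (x.1^-1, x.1))^-1).

Lemma coc_mulC (a b : M) : a * b = b * a.
Proof.
by have /centsP cMM := coc_abelian z; apply: cMM; rewrite inE.
Qed.

Lemma coc_eps_mulr h (a b : M) :
  coc_eps z h (a * b) = coc_eps z h a * coc_eps z h b.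
Proof.
have [/(_ h)/Aut_morphic/morphicP eM _] := coc_modstr z.
by rewrite eM ?inE.
Qed.

Lemma coc_eps_mull g h (a : M) : coc_eps z (g * h) a = coc_eps z h (coc_eps z g a).
Proof. by have [_ ->] := coc_modstr z; rewrite permM. Qed.

Lemma coc_eps1 (a : M) : coc_eps z 1 a = a.
Proof.
by apply: (@perm_inj _ (coc_eps z 1)); rewrite -coc_eps_mull mulg1.
Qed.

Lemma ext_mulA : associative ext_mul.
Proof.
case=> g a [h b] [k c]; rewrite /ext_mul /= mulgA; congr (_, _).
rewrite !coc_eps_mulr -coc_eps_mull.
have [_ cocE] := coc_cocycle z.
rewrite -!mulgA; congr (_ * (_ * _)).
by rewrite [RHS]coc_mulC -(mulgA c) cocE (coc_mulC (coc_val z (h, k))).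
Qed.

Lemma ext_mul1 : left_id ext_one ext_mul.
Proof.
case=> h b; rewrite /ext_mul /ext_one /= mul1g.
have [/(_ h)[-> _] _] := coc_cocycle z.
have -> : coc_eps z h 1 = 1.
  by apply: (mulgI (coc_eps z h 1)); rewrite -coc_eps_mulr !mulg1.
by rewrite mul1g mulg1.
Qed.

Lemma ext_mulV : left_inverse ext_one ext_inv ext_mul.
Proof.
case=> g a; rewrite /ext_mul /ext_inv /ext_one /= mulVg -coc_eps_mull mulVg.
by rewrite coc_eps1 -mulgA mulVg.
Qed.

HB.instance Definition _ := Finite_isGroup.Build (ext z) ext_mulA ext_mul1 ext_mulV.

End Modules.

(* "For all H, M": H and M range over the consistent presentations. *)
Record orderings := Orderings {
  ord_mod : forall H M : cpcp, rel {ffun pcg H -> {perm pcg M}};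
  ord_modP : forall H M : cpcp,
    total_order_on (@is_modstr (pcg H) (pcg M)) (@ord_mod H M);
  ord_map : forall H M : cpcp, rel {ffun pcg H * pcg H -> pcg M};
  ord_mapP : forall H M : cpcp, total_order_on (fun _ => True) (@ord_map H M) }.

Arguments ord_mod : clear implicits.
Arguments ord_map : clear implicits.

Section Tails.
Variables (H M : cpcp) (z : cocycle (pcg H) (pcg M)).
Let n := pc_rank H.
Let m := pc_rank M.

(* w((g_1,1), ..., (g_n,1)) *)
Definition ext_eval (w : seq nat) : ext z :=
  \prod_(i < n) (ext_pair z (pc_gen i) 1) ^+ nth 0%N w i.

(* Only the values t2 i j with i < j matter. *)
Definition is_tail (t1 : 'I_n -> pcg M) (t2 : 'I_n -> 'I_n -> pcg M) : Prop :=
  (forall k, ext_pair z (pc_gen k) 1 ^+ pc_relord H k =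
             ext_eval (pc_pow_rhs H k) * ext_pair z 1 (t1 k)) /\
  (forall i j : 'I_n, (i < j)%N ->
     ext_pair z (pc_gen j) 1 ^ ext_pair z (pc_gen i) 1 =
     ext_eval (pc_conj_rhs H i j) * ext_pair z 1 (t2 i j)).

Definition ext_pcp (t1 : 'I_n -> pcg M) (t2 : 'I_n -> 'I_n -> pcg M) : pcp :=
  Pcp (pc_ord H ++ pc_ord M)
      ([seq pc_pow_rhs H k ++ expo_seq (t1 k) | k : 'I_n <- enum 'I_n] ++
       nseq m (nseq (n + m) 0%N))
      ([seq [seq pc_conj_rhs H i j ++ expo_seq (t2 i j)
               | i : 'I_n <- enum 'I_n & (i < j)%N] | j : 'I_n <- enum 'I_n] ++
       [seq [seq nseq n 0%N ++ expo_seq (coc_eps z (pc_gen i) (pc_gen j))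
               | i : 'I_n <- enum 'I_n] ++ nseq j (unit_word (n + m) (n + j))
          | j : 'I_m <- enum 'I_m]).

End Tails.

(* In the step from can(G/G_k) to can(G/G_(k+1)), K is G_k and L is G_(k+1). *)

Section Step.
Variables (O : orderings) (gT : finGroupType) (G K L : {group gT}).

Section Choices.
Variables (H M : cpcp) (phi : {morphism G / K >-> pcg H})
  (beta : {morphism K / L >-> pcg M}).

(* As phi and beta are onto, this determines
   eps h = beta o mu (phi^-1 h) o beta^-1. *)
Definition induced_modstr (eps : {ffun pcg H -> {perm pcg M}}) : Prop :=
  forall g x, g \in G -> x \in K ->
    eps (phi (coset K g)) (beta (coset L x)) = beta (coset L (x ^ g)).

Definition is_section (tau : coset_of K -> coset_of L) : Prop :=
  tau 1 = 1 /\
  forall a, a \in G / K ->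
    exists2 g, g \in G & coset K g = a /\ coset L g = tau a.

(* As phi is bijective, this determines gamma = beta o gamma' o (phi^-1, phi^-1). *)
Definition induced_cocycle (tau : coset_of K -> coset_of L)
    (gamma : {ffun pcg H * pcg H -> pcg M}) : Prop :=
  forall a b, a \in G / K -> b \in G / K ->
    gamma (phi a, phi b) = beta ((tau (a * b))^-1 * (tau a * tau b)).

End Choices.

Inductive can_step (H : cpcp) : pcp -> Prop :=
| CanStep (p m : nat) (M : cpcp)
    (phi : {morphism G / K >-> pcg H}) (beta : {morphism K / L >-> pcg M})
    (tau : coset_of K -> coset_of L)
    (gamma : {ffun pcg H * pcg H -> pcg M})
    (lambda : cocycle (pcg H) (pcg M))
    (t1 : 'I_(pc_rank H) -> pcg M)
    (t2 : 'I_(pc_rank H) -> 'I_(pc_rank H) -> pcg M) :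
    prime p -> #|K / L| = (p ^ m)%N -> cpcp_val M = pcp_elem p m ->
    isom (G / K) [set: pcg H] phi -> isom (K / L) [set: pcg M] beta ->
    induced_modstr phi beta (coc_eps lambda) ->
    is_minimum (ord_mod O H M) (modstr_orbit (coc_eps lambda)) (coc_eps lambda) ->
    is_section tau -> induced_cocycle phi beta tau gamma ->
    is_minimum (ord_map O H M) (cocycle_class (coc_eps lambda) gamma)
      (coc_val lambda) ->
    is_tail lambda t1 t2 ->
    can_step H (ext_pcp lambda t1 t2).

End Step.

(* The construction depends on choices, so it is a relation: [is_can C I O G P]
   says that P is an output of the construction for G, for some choices. *)

Section Construction.
Variables (C : canonical_filtration) (I : abelian_invariants) (O : orderings).
Variables (gT : finGroupType) (G : {group gT}).

(* P is an output can(G/G_k) *)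
Inductive is_can_quotient : nat -> pcp -> Prop :=
| can_quotient_base : is_can_quotient 2 (can_abelian (ai_inv I (G / cf_term C G 2)))
| can_quotient_step (k : nat) (H : cpcp) (P : pcp) :
    (2 <= k <= cf_len C G)%N -> is_can_quotient k H ->
    can_step O G (cf_term C G k) (cf_term C G k.+1) H P ->
    is_can_quotient k.+1 P.

Definition is_can (P : pcp) : Prop :=
  if G :==: 1 then P = pcp_empty else is_can_quotient (cf_len C G).+1 P.

End Construction.

(* Main.v *)
Set Warnings "-notation-overridden,-redundant-canonical-projection".
Require Import Defs.
From mathcomp Require Import all_boot all_order all_fingroup all_solvable.
From mathcomp Require Import boolp zify.
From Corelib Require Import Setoid Morphisms.

Set Implicit Arguments.
Unset Strict Implicit.
Unset Printing Implicit Defensive.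

Local Open Scope group_scope.

(** The presentation determines the group: if [P] is an output of the
    construction for [G], then [P] is consistent and defines a group isomorphic
    to [G].  Conversely, nothing in the construction depends on more than the
    isomorphism type of [G], because every choice is followed by the selection
    of a least element of a set that does not depend on the choice.

    For the first half, say that a list of elements realizes [P] in a group [A]
    when it satisfies the relations of [P], its normal forms exhaust [A], and
    [A] has as many elements as [P] has normal forms.  Every word can be
    collected into a normal form ([normal_form_exists]); comparing
    cardinalities, a realized presentation is consistent and defines [A]
    ([realizes_consistent], [realizes_isog]).  Realizability passes from a
    kernel and a quotient to an extension ([realizes_extension]).  This gives
    the presentations of abelian groups, where a direct product is an extension
    with trivial tails, and the presentation with tails [ext_pcp], which is
    realized by the group of pairs of its cocycle ([realizes_ext]).

    For the second half, describe the extension of [G / K] by [K / L] inside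
    [G] by a homomorphism [a] of [G] onto [H] with kernel [K], a homomorphism
    [b] of [K] onto [M] with kernel [L], and a map [s] lifting [H] to [G]
    ([ext_datum], [is_lift]).  The orbit in which the module structure is chosen
    is the set of all module structures induced by such pairs [(a, b)]
    ([modstr_orbitE]): two pairs differ by automorphisms of [H] and [M].
    Likewise, the union of classes in which the cocycle is chosen is the set of
    all cocycles induced by such triples [(a, b, s)] for the fixed module
    structure ([cocycle_classE]): changing [a] and [b] compatibly with that
    structure amounts to applying a compatible pair, and changing [s] to adding
    a coboundary.  Hence a step of the construction amounts to taking the least
    element of each of two sets attached to [G], [K] and [L]
    ([can_step_canonical]); an isomorphism respecting the filtration preserves
    both sets ([canonical_step_unique]), so by induction isomorphic groups get
    the same presentation.  Moreover the chosen cocycle, being induced by some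
    triple, defines an extension isomorphic to [G / L] ([ext_epi]), which is
    what the first half needs. *)

(** * Collection of words into normal forms *)

#[local] Instance pc_eq_equiv (P : pcp) : Equivalence (@pc_eq P).
Proof.
by split; [exact: pc_eq_refl | exact: pc_eq_sym | exact: pc_eq_trans].
Qed.

#[local] Instance pc_eq_cat_proper (P : pcp) :
  Proper (@pc_eq P ==> @pc_eq P ==> @pc_eq P) (@cat ('I_(pc_rank P) * bool)).
Proof. by move=> u u' uu' v v' vv'; exact: pc_eq_cat. Qed.

#[local] Instance pc_eq_cons_proper (P : pcp) (l : 'I_(pc_rank P) * bool) :
  Proper (@pc_eq P ==> @pc_eq P) (cons l).
Proof. by move=> u v uv; exact: (pc_eq_cat (pc_eq_refl [:: l]) uv). Qed.

Lemma expo_word_split n (k : 'I_n) a (e : 'I_n -> nat) :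
    (forall i : 'I_n, (i <= k)%N -> e i = 0%N) ->
  expo_word (fun i => if i == k then a else e i) =
    nseq a (k, true) ++ expo_word e.
Proof.
move=> e0; rewrite /expo_word.
have: sorted (fun i j : 'I_n => i < j)%N (enum 'I_n).
  have := iota_ltn_sorted 0 n; rewrite -val_enum_ord sorted_map.
  by apply: sub_sorted => i j.
have: k \in enum 'I_n by rewrite mem_enum.
elim: (enum 'I_n) => //= i s IHs; rewrite inE => /predU1P[<-|ks] ord_s.
  rewrite eqxx e0 //=; congr (_ ++ flatten _).
  apply/eq_in_map => j js; case: eqP => // jk.
  have /allP/(_ _ js) : all (fun j : 'I_n => k < j)%N s.
    by apply: order_path_min ord_s => x y z; exact: ltn_trans.
  by rewrite jk ltnn.
have ltik : (i < k)%N.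
  have /allP/(_ _ ks) // : all (fun j : 'I_n => i < j)%N s.
  by apply: order_path_min ord_s => x y z; exact: ltn_trans.
rewrite e0 ?(ltnW ltik) //= -IHs ?(path_sorted ord_s) //.
by case: eqP ltik => [->|_]; rewrite ?ltnn.
Qed.

Section Collection.
Variable P : pcp.
Hypothesis pcpP : is_pcp P.
Hypothesis ordP_gt0 : forall k, (k < pc_rank P)%N -> (0 < pc_relord P k)%N.
Let n := pc_rank P.
Implicit Types (u v w : word n) (i j k : 'I_n) (e : 'I_n -> nat).

Let from d w := all (fun l : 'I_n * bool => d <= l.1)%N w.

Lemma from_expo_word (d : nat) e :
  (forall i, (i < d)%N -> e i = 0%N) -> from d (expo_word e).
Proof.
move=> e0; apply/allP=> l /flattenP[s /mapP[i _ ->]].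
by case/nseqP=> -> ei_gt0 /=; rewrite leqNgt; apply: contraTN ei_gt0 => /e0->.
Qed.

Lemma expo_word_pos e l : l \in expo_word e -> l.2.
Proof. by case/flattenP=> s /mapP[i _ ->] /nseqP[->]. Qed.

Let from_cat d u v : from d (u ++ v) = from d u && from d v.
Proof. exact: all_cat. Qed.

Let winv w : word n := rev [seq (l.1, ~~ l.2) | l <- w].

Lemma pc_eq_winv w : pc_eq (P := P) (w ++ winv w) [::].
Proof.
elim/last_ind: w => [|w [i b] IHw]; first exact: pc_eq_refl.
rewrite /winv map_rcons rev_rcons -cats1 /= -catA.
rewrite -[[:: (i, b)] ++ _]/([:: (i, b); (i, ~~ b)] ++ winv w).
by rewrite (pc_eq_cancel i b).
Qed.

Lemma from_winv d w : from d w -> from d (winv w).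
Proof. by rewrite /from /winv all_rev all_map. Qed.

Let nf_expo d w e :=
  [/\ forall i, (e i < pc_relord P i)%N, forall i, (i < d)%N -> e i = 0%N
    & pc_eq (P := P) w (expo_word e)].

(** Moving a letter [g_k] to the left across a positive word in later
    generators only conjugates that word. *)
Lemma pc_eq_push k w : from k.+1 w -> (forall l, l \in w -> l.2) ->
  exists2 w', from k.+1 w' & pc_eq (P := P) (w ++ [:: (k, true)]) ((k, true) :: w').
Proof.
elim: w => [|[j b] w IHw] /=; first by exists [::] => //; reflexivity.
case/andP=> ltkj fw pos; have {b pos}[-> pos]: b = true /\ forall l, l \in w -> l.2.
  by split=> [|l lw]; [apply: (pos (j, b)) | apply: pos]; rewrite inE ?eqxx ?lw ?orbT.
have [w' fw' ww'] := IHw fw pos.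
exists (expo_word (nth 0%N (pc_conj_rhs P k j)) ++ w').
  rewrite from_cat fw' andbT; apply: from_expo_word => i lti.
  have [_ _ _ _ /(_ k j ltkj (ltn_ord j))[_ /(_ i (ltn_ord i))]] := pcpP.
  by rewrite ltnNge -ltnS lti => /eqP.
have step : pc_eq (P := P) [:: (j, true); (k, true)]
              ((k, true) :: expo_word (nth 0%N (pc_conj_rhs P k j))).
  rewrite -pc_eq_conj //; symmetry.
  exact: pc_eq_cat (pc_eq_cancel k true) (pc_eq_refl [:: (j, true); (k, true)]).
rewrite [_ ++ _]/= ww'.
exact: pc_eq_cat step (pc_eq_refl w').
Qed.

(** Downward induction on the least letter [d] allowed.  The words of the form
    [g_k^a v] with [a < r_k] and [v] in the later letters are stable under right
    multiplication by letters from [k] on: a letter [g_k] is pushed to the left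
    across [v], and [g_k^-1] is [g_k^(r_k - 1)] times the inverse of the right-hand
    side of the power relation.  The tail [v] is normalised by induction. *)
Lemma collect_from (d : nat) w : (d <= n)%N -> from d w -> exists e, nf_expo d w e.
Proof.
move=> led; rewrite -(subKn led); move: (n - d)%N (leq_subr d n) => {d led} m.
elim: m w => [|m IHm] w lem; rewrite ?subn0.
  case: w => [_|[i b] w /andP[]]; last by rewrite leqNgt ltn_ord.
  exists (fun=> 0%N); split=> // [i|]; first exact: ordP_gt0.
  rewrite (_ : expo_word _ = [::]); first exact: pc_eq_refl.
  by rewrite /expo_word; elim: (enum _).
have ltk : (n - m.+1 < n)%N by lia.
set k := Ordinal ltk; rewrite -[(n - m.+1)%N]/(val k).
have {IHm} IH v : from k.+1 v -> exists e, nf_expo k.+1 v e.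
  have -> : k.+1 = (n - m)%N by rewrite /=; lia.
  by apply: IHm; lia.
pose semi v := exists a v', [/\ (a < pc_relord P k)%N, from k.+1 v'
                    & pc_eq (P := P) v (nseq a (k, true) ++ v')].
have semi_eq u v : pc_eq (P := P) u v -> semi v -> semi u.
  by move=> uv [a [v' [lta fv' vE]]]; exists a, v'; split=> //; rewrite uv.
have semi_gt v u : semi v -> from k.+1 u -> semi (v ++ u).
  case=> a [v' [lta fv' vE]] fu; exists a, (v' ++ u).
  by split; rewrite ?from_cat ?fv' // catA vE; reflexivity.
have powE := pc_eq_pow (P := P) k.
have from_pow : from k.+1 (expo_word (nth 0%N (pc_pow_rhs P k))).
  apply: from_expo_word => i lti.
  have [_ /(_ k ltk)[_ /(_ i (ltn_ord i)) nf_i] _ _ _] := pcpP.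
  by move: nf_i; rewrite ltnNge -ltnS lti => /eqP.
have semi_k v : semi v -> semi (v ++ [:: (k, true)]).
  case=> a [v' [lta fv' vE]]; have [e [_ e0 v'E]] := IH _ fv'.
  have [|w' fw' eE] := pc_eq_push (from_expo_word e0); first exact: expo_word_pos.
  have {eE}vE : pc_eq (P := P) (v ++ [:: (k, true)]) (nseq a.+1 (k, true) ++ w').
    rewrite vE v'E -catA eE -cat1s catA -[[:: _]]/(nseq 1 (k, true)) -nseqD addn1.
    reflexivity.
  have [lta1|] := ltnP a.+1 (pc_relord P k); first by exists a.+1, w'.
  move=> lea1; have {lea1} a1 : a.+1 = pc_relord P k by apply/eqP; rewrite eqn_leq lta.
  exists 0%N, (expo_word (nth 0%N (pc_pow_rhs P k)) ++ w').
  split; rewrite ?ordP_gt0 ?from_cat ?from_pow //.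
  by rewrite vE a1 powE; reflexivity.
have semi_kn v a : semi v -> semi (v ++ nseq a (k, true)).
  elim: a => [|a IHa] sv; first by rewrite cats0.
  by rewrite -[a.+1]addn1 nseqD catA; apply/semi_k/IHa.
have semi_kV v : semi v -> semi (v ++ [:: (k, false)]).
  move=> sv; pose u : word n := expo_word (nth 0%N (pc_pow_rhs P k)).
  have [r rE] : exists r, pc_relord P k = r.+1.
    by exists (pc_relord P k).-1; rewrite prednK ?ordP_gt0.
  suff vE : pc_eq (P := P) (v ++ [:: (k, false)]) ((v ++ nseq r (k, true)) ++ winv u).
    apply: semi_eq vE _.
    by apply: semi_gt; [apply: semi_kn | apply: from_winv].
  rewrite -catA; apply: pc_eq_cat; first exact: pc_eq_refl.
  transitivity ([:: (k, false)] ++ (u ++ winv u)).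
    by rewrite pc_eq_winv cats0; reflexivity.
  have {1}<- : pc_eq (P := P) (nseq r.+1 (k, true)) u by rewrite -rE.
  exact: pc_eq_cat (pc_eq_cancel k false) (pc_eq_refl _).
have semiP v : from k v -> semi v.
  elim/last_ind: v => [_|v [i b] IHv].
    by exists 0%N, [::]; split; rewrite ?ordP_gt0 //; reflexivity.
  rewrite /from all_rcons -cats1 => /andP[/= leki fv].
  move: leki (IHv fv); rewrite leq_eqVlt => /predU1P[eki|ltki] sv.
    have <- : k = i by exact: ord_inj.
    by case: b; [apply: semi_k | apply: semi_kV].
  by apply: semi_gt => //; rewrite /from /= ltki.
move=> /semiP[a [v [lta fv wE]]]; have [e [lte e0 vE]] := IH _ fv.
exists (fun i => if i == k then a else e i); split=> [i|i ltik|].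
- by case: eqP => [->|_].
- case: eqP => [ik|_]; first by rewrite ik ltnn in ltik.
  by rewrite e0 // ltnS ltnW.
by rewrite expo_word_split // wE vE; reflexivity.
Qed.

Lemma normal_form_exists w : exists e : nform P, pc_eq w (nf_word e).
Proof.
have [//||e [lte _ wE]] := @collect_from 0 w; first exact/allP.
pose f : nform P := [ffun i => Ordinal (lte i)]; exists f.
rewrite wE /nf_word (_ : expo_word e = expo_word (fun i => f i : nat)).
  reflexivity.
by congr flatten; apply: eq_map => i; rewrite ffunE.
Qed.

End Collection.

(** * Groups realizing a presentation *)

Section ExpoProd.
Variable gT : finGroupType.
Implicit Types (s : seq gT) (w : seq nat).

Definition expo_prod s w : gT := \prod_(xe <- zip s w) xe.1 ^+ xe.2.

Lemma expo_prod_cat s1 s2 w1 w2 : size s1 = size w1 ->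
  expo_prod (s1 ++ s2) (w1 ++ w2) = expo_prod s1 w1 * expo_prod s2 w2.
Proof. by move=> eq_sz; rewrite /expo_prod zip_cat // big_cat. Qed.

Lemma expo_prodE n s w : size s = n -> size w = n ->
  expo_prod s w = \prod_(i < n) nth 1 s i ^+ nth 0%N w i.
Proof.
move=> szs szw; rewrite /expo_prod (big_nth (1, 0%N)) size_zip szs szw minnn.
by rewrite big_mkord; apply: eq_bigr => i _; rewrite nth_zip ?szs.
Qed.

Lemma expo_prod0 s m : expo_prod s (nseq m 0%N) = 1.
Proof.
elim: s m => [|x s IHs] [|m]; rewrite /expo_prod /= ?big_nil //.
by rewrite big_cons mul1g; apply: IHs.
Qed.

Lemma size_unit_word n j : size (unit_word n j) = n.
Proof. exact: size_mkseq. Qed.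

Lemma nth_unit_word n j l : (l < n)%N -> nth 0%N (unit_word n j) l = (l == j).
Proof. by move=> ltl; rewrite nth_mkseq. Qed.

Lemma unit_word0 n : unit_word n.+1 0 = 1%N :: nseq n 0%N.
Proof.
apply: (@eq_from_nth _ 0%N) => [|i]; rewrite size_unit_word ?[RHS]/= ?size_nseq // => lti.
by rewrite nth_unit_word //; case: i lti => //= i _; rewrite nth_nseq if_same.
Qed.

Lemma unit_wordS n j : unit_word n.+1 j.+1 = 0%N :: unit_word n j.
Proof.
apply: (@eq_from_nth _ 0%N) => [|i]; rewrite size_unit_word ?[RHS]/= ?size_unit_word // => lti.
by rewrite nth_unit_word //; case: i lti => //= i lti; rewrite nth_unit_word.
Qed.

Lemma unit_wordD n m j : unit_word (n + m) (n + j) = nseq n 0%N ++ unit_word m j.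
Proof. by elim: n => //= n IHn; rewrite !addSn unit_wordS IHn. Qed.

Lemma expo_prod_unit s j : expo_prod s (unit_word (size s) j) = nth 1 s j.
Proof.
elim: s j => [|x s IHs] [|j] //; rewrite ?[LHS]big_nil //.
  by rewrite unit_word0 [LHS]big_cons -/(expo_prod s _) expo_prod0 mulg1.
by rewrite unit_wordS [LHS]big_cons mul1g; apply: IHs.
Qed.

Lemma mem_expo_prod (A : {group gT}) s w : {subset s <= A} -> expo_prod s w \in A.
Proof.
move=> sA; rewrite /expo_prod big_seq; apply: group_prod => -[x e] xe.
apply/groupX/sA; move: xe; elim: s w {sA} => [|y s IHs] [|k w] //=.
by rewrite !inE => /predU1P[[-> _]|/IHs->]; rewrite ?eqxx ?orbT.
Qed.

End ExpoProd.

Lemma morph_expo_prod (gT hT : finGroupType) (A : {group gT})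
    (f : gT -> hT) s w : {in A &, {morph f : x y / x * y}} -> {subset s <= A} ->
  f (expo_prod s w) = expo_prod (map f s) w.
Proof.
move=> fM; pose g := Morphism fM.
have f1 : f 1 = 1 by exact: (morph1 g).
have fX x e : x \in A -> f (x ^+ e) = f x ^+ e by exact: (morphX g).
elim: s w => [|x s IHs] [|e w] sA; rewrite /expo_prod /= ?big_nil // !big_cons.
have [xA sA'] : x \in A /\ {subset s <= A}.
  by split=> [|y ys]; apply: sA; rewrite inE ?eqxx ?ys ?orbT.
rewrite fM ?groupX ?fX //=; last exact: mem_expo_prod sA'.
by congr (_ * _); apply: IHs.
Qed.

(** A concrete model of the group of [P].  Since normal forms are as many as the
    product of the relative orders, [rz_card] and [rz_nf] together say that each
    element has exactly one of them; existence is the half that is easy to check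
    in examples. *)
Record realizes (gT : finGroupType) (P : pcp) (A : {set gT}) (s : seq gT) : Prop :=
  Realizes {
    rz_pcp : is_pcp P;
    rz_size : size s = pc_rank P;
    rz_sub : {subset s <= A};
    rz_pow : forall k, (k < pc_rank P)%N ->
      nth 1 s k ^+ pc_relord P k = expo_prod s (pc_pow_rhs P k);
    rz_conj : forall i j, (i < j)%N -> (j < pc_rank P)%N ->
      nth 1 s j ^ nth 1 s i = expo_prod s (pc_conj_rhs P i j);
    rz_card : #|A| = (\prod_(r <- pc_ord P) r)%N;
    rz_nf : forall x, x \in A ->
      exists2 w, all2 ltn w (pc_ord P) & x = expo_prod s w }.

Section WordEval.
Variables (gT : finGroupType) (s : seq gT).

Definition word_eval n (w : word n) : gT :=
  \prod_(l <- w) if l.2 then nth 1 s l.1 else (nth 1 s l.1)^-1.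

Lemma word_eval_cat n (u v : word n) : word_eval (u ++ v) = word_eval u * word_eval v.
Proof. exact: big_cat. Qed.

Lemma word_eval_nseq n (i : 'I_n) a : word_eval (nseq a (i, true)) = nth 1 s i ^+ a.
Proof.
by elim: a => [|a IHa]; rewrite [LHS]/= /word_eval /= ?big_nil // big_cons expgS -IHa.
Qed.

Lemma word_eval_expo n (e : 'I_n -> nat) :
  word_eval (expo_word e) = \prod_(i < n) nth 1 s i ^+ e i.
Proof.
rewrite /word_eval /expo_word big_flatten big_map enumT [index_enum _]unlock.
by apply: eq_bigr => i _; rewrite -word_eval_nseq.
Qed.

End WordEval.

Section Realizes.
Variables (gT : finGroupType) (P : pcp) (A : {group gT}) (s : seq gT).
Hypothesis rzP : realizes P A s.
Let n := pc_rank P.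

Lemma pc_relord_gt0 k : (k < n)%N -> (0 < pc_relord P k)%N.
Proof.
move=> ltk; have := cardG_gt0 A; rewrite (rz_card rzP) (big_nth 0%N).
rewrite big_mkord => prod_gt0.
have/dvdn_gt0: (pc_relord P k %| \prod_(i < n) nth 0%N (pc_ord P) i)%N; last exact.
by rewrite (bigD1 (Ordinal ltk)) //= dvdn_mulr.
Qed.

Lemma word_eval_seq (w : seq nat) : size w = n ->
  word_eval s (expo_word (fun i : 'I_n => nth 0%N w i)) = expo_prod s w.
Proof. by move=> szw; rewrite word_eval_expo (expo_prodE (rz_size rzP) szw). Qed.

Lemma word_eval_pc_eq (u v : word n) : pc_eq u v -> word_eval s u = word_eval s v.
Proof.
elim=> {u v} [//|//|u v w _ -> _ ->//|u u' v v' _ uu' _ vv'|i b|k|i j ltij].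
- by rewrite !word_eval_cat uu' vv'.
- rewrite /word_eval big_cons big_seq1 big_nil /=.
  by case: b; rewrite ?mulgV ?mulVg.
- have [_ /(_ k (ltn_ord k))[szk _] _ _ _] := rz_pcp rzP.
  by rewrite word_eval_nseq word_eval_seq // (rz_pow rzP).
- have [_ _ _ _ /(_ i j ltij (ltn_ord j))[szij _]] := rz_pcp rzP.
  rewrite word_eval_seq // -(rz_conj rzP) //.
  by rewrite /word_eval !big_cons big_nil /= mulg1 conjgE mulgA.
Qed.

Lemma card_nform : #|nform P| = (\prod_(r <- pc_ord P) r)%N.
Proof.
rewrite card_dep_ffun foldrE /image_mem big_map.
rewrite (big_nth 0%N) big_mkord big_enum /=; apply: eq_bigr => i _.
by rewrite card_ord.
Qed.

Let nf_eval (e : nform P) : gT := word_eval s (nf_word e).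

Lemma nf_eval_seq (w : seq nat) : all2 ltn w (pc_ord P) ->
  exists e : nform P, nf_eval e = expo_prod s w.
Proof.
move=> wP; have [szw ltw] : size w = n /\ forall i : 'I_n, (nth 0%N w i < pc_relord P i)%N.
  rewrite all2E in wP; case/andP: wP => /eqP szw /(all_nthP (0%N, 0%N)) ltw.
  split=> // i; have := ltw i; rewrite size_zip szw minnn nth_zip //=.
  by apply; apply: ltn_ord.
exists [ffun i => Ordinal (ltw i)]; rewrite /nf_eval word_eval_expo.
rewrite (expo_prodE (rz_size rzP) szw); apply: eq_bigr => i _.
by rewrite ffunE.
Qed.

Lemma nf_eval_inj : injective nf_eval.
Proof.
have sA : A \subset [set nf_eval e | e : nform P].
  apply/subsetP=> x /(rz_nf rzP)[w wP ->]; apply/imsetP.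
  by have [e <-] := nf_eval_seq wP; exists e.
have/imset_injP inj: #|[set nf_eval e | e : nform P]| == #|nform P|.
  rewrite eqn_leq leq_imset_card card_nform -(rz_card rzP).
  exact: subset_leq_card.
by move=> e1 e2; apply: inj.
Qed.

(** The normal forms are as many as the elements of the group, and they reach
    all of them, so two different normal forms have different values. *)
Lemma realizes_consistent : consistent P.
Proof.
move=> w; have [e we] := normal_form_exists (rz_pcp rzP) pc_relord_gt0 w.
exists e; split=> // e' we'; apply: nf_eval_inj.
by rewrite /nf_eval -(word_eval_pc_eq we) -(word_eval_pc_eq we').
Qed.

End Realizes.

(** Evaluation of normal forms: it respects products because the relations hold
    in [A]. *)
Lemma realizes_isog (gT : finGroupType) (P : cpcp) (A : {group gT}) s :
  realizes P A s -> [set: pcg P] \isog A.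
Proof.
move=> rzP; pose f (x : pcg P) := word_eval s (pc_word x).
have fM : {in [set: pcg P] &, {morph f : x y / x * y}}.
  move=> x y _ _; rewrite /f -word_eval_cat; apply: esym.
  exact: (word_eval_pc_eq rzP (pc_collectP _)).
apply/isogP; exists (Morphism fM).
  by apply/injmP => x y _ _; apply: (nf_eval_inj rzP).
apply/eqP; rewrite eqEsubset; apply/andP; split; apply/subsetP=> x; last first.
  case/(rz_nf rzP)=> w wP ->; have [e <-] := nf_eval_seq rzP wP.
  exact: (mem_morphim (Morphism fM) (x := (e : pcg P))).
case/morphimP=> y _ _ -> /=; rewrite /f /word_eval; apply: group_prod => l _.
have gA : nth 1 s l.1 \in A by apply/(rz_sub rzP)/mem_nth; rewrite (rz_size rzP).
by case: ifP; rewrite ?groupV.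
Qed.

Section OwnGenerators.
Variable P : cpcp.
Let n := pc_rank P.

Definition pc_gens : seq (pcg P) := [seq pc_gen i | i <- enum 'I_n].

Lemma size_pc_gens : size pc_gens = n.
Proof. by rewrite size_map size_enum_ord. Qed.

Lemma nth_pc_gens (i : 'I_n) : nth 1 pc_gens i = pc_gen i.
Proof. by rewrite (nth_map i) ?size_enum_ord // nth_ord_enum. Qed.

Lemma pc_collectM (u v : word n) : pc_collect (u ++ v) = pc_collect u * pc_collect v.
Proof. by rewrite -pcg_mulE. Qed.

Lemma pc_collect_eval (w : word n) : pc_collect w = word_eval pc_gens w.
Proof.
elim: w => [|[i b] w IHw]; first by rewrite /word_eval big_nil.
rewrite -cat1s pc_collectM IHw [RHS]big_cons /= nth_pc_gens; congr (_ * _).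
case: b => //; apply/eqP; rewrite eq_sym eq_invg_mul /pc_gen -pc_collectM /=.
by apply/eqP/pc_collect_eq/pc_eq_cancel.
Qed.

Lemma size_expo_seq (x : pcg P) : size (expo_seq x) = n.
Proof. by rewrite size_map size_enum_ord. Qed.

Lemma nth_expo_seq (x : pcg P) (i : 'I_n) : nth 0%N (expo_seq x) i = pc_expo x i.
Proof. by rewrite (nth_map i) ?size_enum_ord // nth_ord_enum. Qed.

Lemma expo_seqE (x : pcg P) : x = expo_prod pc_gens (expo_seq x).
Proof.
rewrite -{1}(pc_wordK x) pc_collect_eval word_eval_expo.
rewrite (expo_prodE size_pc_gens (size_expo_seq x)); apply: eq_bigr => i _.
by rewrite nth_expo_seq.
Qed.

Lemma expo_seq_lt (x : pcg P) : all2 ltn (expo_seq x) (pc_ord P).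
Proof.
rewrite all2E size_expo_seq eqxx /=; apply/(all_nthP (0%N, 0%N)) => i.
rewrite size_zip size_expo_seq minnn => lti.
rewrite nth_zip ?size_expo_seq //=.
by have := nth_expo_seq x (Ordinal lti) => /= ->; apply: ltn_ord.
Qed.

Lemma realizes_pcg : realizes P [set: pcg P] pc_gens.
Proof.
have pcpP := cpcp_is_pcp P.
have evalE w : size w = n ->
    pc_collect (expo_word (fun i : 'I_n => nth 0%N w i)) = expo_prod pc_gens w.
  move=> szw; rewrite pc_collect_eval word_eval_expo.
  by rewrite (expo_prodE size_pc_gens szw).
split=> [||x _|k ltk|i j ltij ltj||x _]; first exact: pcpP.
- exact: size_pc_gens.
- by rewrite inE.
- have [_ /(_ k ltk)[szk _] _ _ _] := pcpP.
  rewrite -evalE // -(pc_collect_eq (pc_eq_pow (Ordinal ltk))).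
  by rewrite pc_collect_eval word_eval_nseq.
- have [_ _ _ _ /(_ i j ltij ltj)[szij _]] := pcpP.
  rewrite -evalE //.
  rewrite -(pc_collect_eq (@pc_eq_conj P (Ordinal (ltn_trans ltij ltj)) (Ordinal ltj) ltij)).
  by rewrite pc_collect_eval /word_eval !big_cons big_nil /= mulg1 conjgE mulgA.
- by rewrite cardsT card_nform.
- by exists (expo_seq x); [apply: expo_seq_lt | apply: expo_seqE].
Qed.

End OwnGenerators.

(** The two other fields are proofs. *)
Lemma cpcp_inj : injective cpcp_val.
Proof.
case=> P p c [Q p' c'] /= PQ; rewrite PQ in p c *.
by rewrite (Prop_irrelevance p p') (Prop_irrelevance c c').
Qed.

Lemma realizes_cpcp (gT : finGroupType) P (A : {group gT}) s :
  realizes P A s -> exists2 Q : cpcp, cpcp_val Q = P & [set: pcg Q] \isog A.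
Proof.
move=> rzP; exists (CPcp (rz_pcp rzP) (realizes_consistent rzP)) => //.
exact: (realizes_isog (P := CPcp _ _) rzP).
Qed.

(** Both groups are isomorphic to the group defined by [P]. *)
Lemma realizes_unique (gT hT : finGroupType) P (A : {group gT}) (B : {group hT}) s t :
  realizes P A s -> realizes P B t -> A \isog B.
Proof.
move=> rzA rzB; have [Q QP isoQA] := realizes_cpcp rzA.
rewrite -QP in rzB; rewrite isog_sym in isoQA.
exact: isog_trans isoQA (realizes_isog rzB).
Qed.

Lemma realizes_morphim (gT hT : finGroupType) P (A : {group gT}) s
    (f : {morphism A >-> hT}) :
  'injm f -> realizes P A s -> realizes P (f @* A) (map f s).
Proof.
move=> injf rzA; have fM := morphM f; have sA := rz_sub rzA.
split; first exact: (rz_pcp rzA).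
- by rewrite size_map (rz_size rzA).
- by move=> _ /mapP[x xs ->]; apply: mem_morphim; exact: sA.
- move=> k ltk; have ltks : (k < size s)%N by rewrite (rz_size rzA).
  rewrite (nth_map 1) // -morphX ?sA ?mem_nth // (rz_pow rzA) //.
  exact: morph_expo_prod fM _.
- move=> i j ltij ltj; have ltjs : (j < size s)%N by rewrite (rz_size rzA).
  have ltis : (i < size s)%N by apply: ltn_trans ltij ltjs.
  rewrite !(nth_map 1) // -morphJ ?sA ?mem_nth // (rz_conj rzA) //.
  exact: morph_expo_prod fM _.
- by rewrite card_injm // (rz_card rzA).
- move=> y /morphimP[x _ /(rz_nf rzA)[w wP ->] ->].
  by exists w => //; apply: morph_expo_prod fM _.
Qed.

(** * Presentations of extensions and of abelian groups *)

Lemma nth_cat_lt (T : Type) (x0 : T) s1 s2 i :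
  (i < size s1)%N -> nth x0 (s1 ++ s2) i = nth x0 s1 i.
Proof. by move=> lti; rewrite nth_cat lti. Qed.

Lemma nth_cat_add (T : Type) (x0 : T) s1 s2 n i :
  size s1 = n -> nth x0 (s1 ++ s2) (n + i) = nth x0 s2 i.
Proof. by move=> <-; rewrite nth_cat ltnNge leq_addr addKn. Qed.

Lemma all2_ltnP (w o : seq nat) :
  all2 ltn w o <->
  size w = size o /\ forall l, (l < size o)%N -> (nth 0%N w l < nth 0%N o l)%N.
Proof.
rewrite all2E; split=> [/andP[/eqP szw /(all_nthP (0%N, 0%N)) ltw]|[szw ltw]].
  split=> // l ltl; have := ltw l; rewrite size_zip szw minnn nth_zip //=.
  exact.
rewrite szw eqxx; apply/(all_nthP (0%N, 0%N)) => l.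
by rewrite size_zip szw minnn nth_zip //= => /ltw.
Qed.

Section NormalFormWords.
Variables (P Q R : pcp).
Hypothesis ordR : pc_ord R = pc_ord P ++ pc_ord Q.
Let n := pc_rank P.
Let m := pc_rank Q.

Lemma pc_rank_cat : pc_rank R = (n + m)%N.
Proof. by rewrite /pc_rank ordR size_cat. Qed.

Lemma pc_relord_catl k : (k < n)%N -> pc_relord R k = pc_relord P k.
Proof. by move=> ltk; rewrite /pc_relord ordR nth_cat_lt. Qed.

Lemma pc_relord_catr k : pc_relord R (n + k) = pc_relord Q k.
Proof. by rewrite /pc_relord ordR nth_cat_add. Qed.

Lemma nf_above_catl k w w' : (k < n)%N -> nf_above P k w ->
  all2 ltn w' (pc_ord Q) -> nf_above R k (w ++ w').
Proof.
move=> ltk [szw nfw] /all2_ltnP[szw' ltw'].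
split=> [|l]; rewrite pc_rank_cat ?size_cat ?szw ?szw' //.
have [ltln _|lenl ltl] := ltnP l n.
  by rewrite nth_cat_lt ?szw // pc_relord_catl //; apply: nfw.
rewrite -(subnKC lenl) nth_cat_add // pc_relord_catr ltn_addr //.
by apply: ltw'; rewrite -/(pc_rank Q) -/m; lia.
Qed.

Lemma nf_above_catr k w : nf_above Q k w -> nf_above R (n + k) (nseq n 0%N ++ w).
Proof.
move=> [szw nfw]; split=> [|l]; rewrite pc_rank_cat ?size_cat ?size_nseq ?szw //.
have [ltln _|lenl ltl] := ltnP l n.
  rewrite nth_cat_lt ?size_nseq // nth_nseq if_same.
  by rewrite ltnNge (leq_trans (ltnW ltln)) ?leq_addr.
rewrite -(subnKC lenl) nth_cat_add ?size_nseq // pc_relord_catr ltn_add2l.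
by apply: nfw; rewrite -/m; lia.
Qed.

End NormalFormWords.

Lemma nf_above0 (P : pcp) k : (forall l, (l < pc_rank P)%N -> (0 < pc_relord P l)%N) ->
  nf_above P k (nseq (pc_rank P) 0%N).
Proof.
move=> ord_gt0; split=> [|l ltl]; first by rewrite size_nseq.
by rewrite nth_nseq if_same; case: ifP => // _; apply: ord_gt0.
Qed.

Lemma all_pos_relord (P : pcp) : (0 < \prod_(r <- pc_ord P) r)%N ->
  forall l, (l < pc_rank P)%N -> (0 < pc_relord P l)%N.
Proof.
rewrite /pc_rank /pc_relord; elim: (pc_ord P) => //= r o IHo.
by rewrite big_cons muln_gt0 => /andP[r_gt0 /IHo{}IHo] [|l] //= /IHo.
Qed.

Section Extension.
Variables (gT : finGroupType) (P Q R : pcp) (G N : {group gT}) (s t : seq gT).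
Let n := pc_rank P.
Let m := pc_rank Q.

(** Let [N] be realized by [t].  Generators [s] that satisfy the relations of [P]
    modulo [N] combine with [t] to a realization of [G]: a relation of [P] acquires
    as tail its error term, a normal form in [t], and conjugation of [t] by [s] is
    described by further normal forms in [t].  The normal form of an element is
    that of its image modulo [N] followed by that of a factor in [N]. *)
Lemma realizes_extension :
  is_pcp P -> size s = n -> {subset s <= G} -> N \subset G -> realizes Q N t ->
  #|G| = ((\prod_(r <- pc_ord P) r) * #|N|)%N ->
  (forall x, x \in G -> exists2 w, all2 ltn w (pc_ord P)
    & exists2 y, y \in N & x = expo_prod s w * y) ->
  pc_ord R = pc_ord P ++ pc_ord Q ->
  size (pc_pow R) = (n + m)%N -> size (pc_conj R) = (n + m)%N ->
  (forall j, (j < n + m)%N -> size (nth [::] (pc_conj R) j) = j) ->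
  (forall k, (k < n)%N -> exists w,
    [/\ pc_pow_rhs R k = pc_pow_rhs P k ++ w, all2 ltn w (pc_ord Q)
      & nth 1 s k ^+ pc_relord P k = expo_prod s (pc_pow_rhs P k) * expo_prod t w]) ->
  (forall k, (k < m)%N -> pc_pow_rhs R (n + k) = nseq n 0%N ++ pc_pow_rhs Q k) ->
  (forall i j, (i < j)%N -> (j < n)%N -> exists w,
    [/\ pc_conj_rhs R i j = pc_conj_rhs P i j ++ w, all2 ltn w (pc_ord Q)
      & nth 1 s j ^ nth 1 s i = expo_prod s (pc_conj_rhs P i j) * expo_prod t w]) ->
  (forall i j, (i < n)%N -> (j < m)%N -> exists w,
    [/\ pc_conj_rhs R i (n + j) = nseq n 0%N ++ w, all2 ltn w (pc_ord Q)
      & nth 1 t j ^ nth 1 s i = expo_prod t w]) ->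
  (forall i j, (i < j)%N -> (j < m)%N ->
    pc_conj_rhs R (n + i) (n + j) = nseq n 0%N ++ pc_conj_rhs Q i j) ->
  realizes R G (s ++ t).
Proof.
move=> pcpP szs sG sNG rzN cardG nfG ordR szpow szconj szrow powP powQ conjP conjPQ conjQ.
have pcpQ := rz_pcp rzN; have szt := rz_size rzN.
have rkR := pc_rank_cat ordR; rewrite -/n -/m in rkR.
have ordP_gt0 : forall l, (l < n)%N -> (0 < pc_relord P l)%N.
  apply: all_pos_relord; have := cardG_gt0 G.
  by rewrite cardG muln_gt0 => /andP[].
have evall w w' : size w = n ->
    expo_prod (s ++ t) (w ++ w') = expo_prod s w * expo_prod t w'.
  by move=> szw; rewrite expo_prod_cat ?szs ?szw.
have evalr w : expo_prod (s ++ t) (nseq n 0%N ++ w) = expo_prod t w.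
  by rewrite evall ?size_nseq // expo_prod0 mul1g.
have [_ powP' _ _ conjP'] := pcpP; have [_ powQ' _ _ conjQ'] := pcpQ.
split.
- split=> [|k||j|i j ltij]; rewrite rkR //; [|exact: szrow|]; last first.
    move=> ltj; have [ltjn|lenj] := ltnP j n.
      have [w [-> ltw _]] := conjP i j ltij ltjn.
      apply: (nf_above_catl ordR) => //; first exact: ltn_trans ltij _.
      exact: conjP'.
    have ltjm : (j - n < m)%N by lia.
    rewrite -(subnKC lenj); have [ltin|leni] := ltnP i n.
      have [w [-> ltw _]] := conjPQ i (j - n)%N ltin ltjm.
      by apply: (nf_above_catl ordR) => //; apply: nf_above0.
    have ltij' : (i - n < j - n)%N by lia.
    rewrite -(subnKC leni) conjQ //; apply: (nf_above_catr ordR).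
    exact: conjQ'.
    move=> ltk; have [ltkn|lenk] := ltnP k n.
      have [w [-> ltw _]] := powP k ltkn.
      by apply: (nf_above_catl ordR) => //; apply: powP'.
    have ltkm : (k - n < m)%N by lia.
    by rewrite -(subnKC lenk) powQ //; apply: (nf_above_catr ordR); apply: powQ'.
- by rewrite size_cat szs szt.
- move=> x; rewrite mem_cat => /orP[/sG//|/(rz_sub rzN)].
  exact: (subsetP sNG).
- rewrite rkR => k ltk; have [ltkn|lenk] := ltnP k n.
    have [w [-> _ sE]] := powP k ltkn; have [szw _] := powP' k ltkn.
    by rewrite nth_cat_lt ?szs // (pc_relord_catl ordR) // evall.
  have ltkm : (k - n < m)%N by lia.
  rewrite -(subnKC lenk) powQ // evalr nth_cat_add // (pc_relord_catr ordR).
  exact: (rz_pow rzN).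
- rewrite rkR => i j ltij ltj; have [ltjn|lenj] := ltnP j n.
    have ltin := ltn_trans ltij ltjn.
    have [w [-> _ sE]] := conjP i j ltij ltjn; have [szw _] := conjP' i j ltij ltjn.
    by rewrite !nth_cat_lt ?szs // evall.
  have ltjm : (j - n < m)%N by lia.
  rewrite -(subnKC lenj); have [ltin|leni] := ltnP i n.
    have [w [-> _ tE]] := conjPQ i (j - n)%N ltin ltjm.
    by rewrite evalr nth_cat_add // nth_cat_lt ?szs.
  have ltij' : (i - n < j - n)%N by lia.
  rewrite -(subnKC leni) conjQ // !nth_cat_add // evalr.
  exact: (rz_conj rzN).
- by rewrite ordR big_cat /= cardG (rz_card rzN).
- move=> x /nfG[w ltw [y /(rz_nf rzN)[w' ltw' ->] ->]].
  have [/(_ ltw)[szw _] _] := all2_ltnP w (pc_ord P); exists (w ++ w'); last by rewrite evall.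
  by rewrite ordR; elim: w (pc_ord P) ltw {szw} => [|e w IHw] [|r o] //= /andP[-> /IHw].
Qed.

End Extension.

Lemma is_pcp_unit o : all (ltn 1%N) o ->
  is_pcp (Pcp o (mkseq (fun k => unit_word (size o) k.+1) (size o)) (unit_conj (size o))).
Proof.
move=> /(all_nthP 0%N)o_gt1; have nf_unit i j : (i < j)%N -> nf_above (Pcp o (mkseq
    (fun k => unit_word (size o) k.+1) (size o)) (unit_conj (size o))) i (unit_word (size o) j).
  move=> ltij; split=> [|l ltl]; first exact: size_unit_word.
  rewrite nth_unit_word //; case: eqP => [lj|_]; last first.
    by case: ifP => // _; apply: ltnW; apply: o_gt1.
  by rewrite lj ltij; apply: o_gt1; rewrite -lj.
split=> [|k ltk||j ltj|i j ltij ltj]; rewrite ?size_mkseq //.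
- by rewrite /pc_pow_rhs nth_mkseq //; apply: nf_unit.
- by rewrite nth_mkseq // size_nseq.
- by rewrite /pc_conj_rhs nth_mkseq // nth_nseq ltij; apply: nf_unit.
Qed.

Lemma realizes_empty (gT : finGroupType) : realizes pcp_empty [1 gT] [::].
Proof.
split=> //; first by rewrite cards1 big_nil.
by move=> x /set1P->; exists [::]; rewrite /expo_prod ?big_nil.
Qed.

Section Cyclic.
Variable gT : finGroupType.
Implicit Types (x : gT) (o : seq nat).

(** The generators [x, x^r_0, x^(r_0 r_1), ...], each being the power of the
    previous one that the presentation [can_cyclic] prescribes. *)
Fixpoint power_chain x o : seq gT :=
  if o is r :: o' then x :: power_chain (x ^+ r) o' else [::].

Lemma size_power_chain x o : size (power_chain x o) = size o.
Proof. by elim: o x => //= r o IHo x; rewrite IHo. Qed.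

Lemma mem_power_chain x o y : y \in power_chain x o -> y \in <[x]>.
Proof.
elim: o x => //= r o IHo x; rewrite inE => /predU1P[->|/IHo]; first exact: cycle_id.
by apply: subsetP; rewrite cycle_subG mem_cycle.
Qed.

Lemma nth_power_chain x o k : (k < size o)%N -> x ^+ (\prod_(r <- o) r) = 1 ->
  nth 1 (power_chain x o) k ^+ nth 0%N o k = nth 1 (power_chain x o) k.+1.
Proof.
elim: o x k => //= r o IHo x k ltk; rewrite big_cons expgM => xo1.
case: k ltk => [_|k ltk] /=; last by rewrite IHo.
by case: o xo1 {IHo} => //=; rewrite big_nil expg1.
Qed.

(** Mixed radix expansion of the exponent, with the relative orders as radices. *)
Lemma expo_prod_power_chain x o k : (k < \prod_(r <- o) r)%N ->
  exists2 w, all2 ltn w o & x ^+ k = expo_prod (power_chain x o) w.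
Proof.
elim: o x k => [|r o IHo] x k.
  rewrite big_nil ltnS leqn0 => /eqP->.
  by exists [::]; rewrite // /expo_prod big_nil.
rewrite big_cons => ltk; have r_gt0 : (0 < r)%N by case: r ltk.
have [|w wP xE] := IHo (x ^+ r) (k %/ r)%N; first by rewrite ltn_divLR // mulnC.
exists (k %% r :: w)%N; first by rewrite /= ltn_mod r_gt0.
rewrite [RHS]big_cons /= -/(expo_prod _ _) -xE -expgM -expgD addnC mulnC.
by rewrite -divn_eq.
Qed.

Lemma realizes_cyclic x : realizes (can_cyclic #[x]) <[x]> (power_chain x (prime_list #[x])).
Proof.
set o := prime_list _; have o_gt1 : all (ltn 1%N) o.
  rewrite all_rev; apply/allP=> p /flattenP[s /mapP[[q e] qe ->]] /nseqP[-> _].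
  by apply: prime_gt1; have [] := mem_prime_decomp qe.
have prod_o : (\prod_(r <- o) r)%N = #[x].
  rewrite (perm_big _ (permEl (perm_rev _))) /= big_flatten big_map.
  rewrite [RHS](prod_prime_decomp (order_gt0 x)).
  by apply: eq_bigr => -[p e] _; rewrite big_nseq iter_muln_1.
split.
- exact: is_pcp_unit.
- exact: size_power_chain.
- exact: mem_power_chain.
- move=> k ltk; rewrite nth_power_chain ?prod_o ?expg_order //.
  by rewrite /pc_pow_rhs nth_mkseq // -(size_power_chain x) expo_prod_unit.
- move=> i j ltij ltj.
  rewrite /pc_conj_rhs nth_mkseq // nth_nseq ltij -(size_power_chain x) expo_prod_unit.
  apply: conjg_fixP; apply/commgP.
  have cyc k : (k < size o)%N -> nth 1 (power_chain x o) k \in <[x]>.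
    by move=> ltk; apply: mem_power_chain (mem_nth _ _); rewrite size_power_chain.
  exact: (centsP (cycle_abelian x)) (cyc _ ltj) _ (cyc _ (ltn_trans ltij ltj)).
- by rewrite prod_o.
- move=> y /cyclePmin[k ltk ->]; apply: expo_prod_power_chain.
  by rewrite prod_o.
Qed.

End Cyclic.

Section Product.
Variables P Q : pcp.
Let n := pc_rank P.
Let m := pc_rank Q.

(** A direct product is an extension with trivial tails and trivial action; the
    words [unit_word] on the right-hand sides are normal forms because the
    relative orders of [Q] exceed one. *)
Lemma realizes_prod (gT : finGroupType) (A B G : {group gT}) (s t : seq gT) :
  realizes P A s -> realizes Q B t -> all (ltn 1%N) (pc_ord Q) -> A \x B = G ->
  realizes (pcp_prod P Q) G (s ++ t).
Proof.
move=> rzA rzB oQ_gt1 defG; have [_ mulAB cAB tiAB] := dprodP defG.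
have [szpow powP szconj szrow conjP] := rz_pcp rzA.
have [szpow' powQ szconj' szrow' conjQ] := rz_pcp rzB.
have [sAG sBG] : A \subset G /\ B \subset G by rewrite -mulAB mulG_subl mulG_subr.
have lt0 : all2 ltn (nseq m 0%N) (pc_ord Q).
  apply/all2_ltnP; rewrite size_nseq; split=> // l ltl.
  by rewrite nth_nseq if_same; apply: ltnW; apply: (all_nthP 0%N oQ_gt1).
have conjQE i j : (i < n + j)%N -> (j < m)%N -> pc_conj_rhs (pcp_prod P Q) i (n + j) =
    nth [::] (nseq n (unit_word (n + m) (n + j)) ++
              map (fun w => nseq n 0%N ++ w) (nth [::] (pc_conj Q) j)) i.
  move=> lti ltj.
  by rewrite /pc_conj_rhs /= nth_cat_add ?size_map // nth_mkseq.
apply: (realizes_extension (rz_pcp rzA) (rz_size rzA) _ sBG rzB); rewrite -/n -/m.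
- by move=> x /(rz_sub rzA); apply: (subsetP sAG).
- by rewrite -(dprod_card defG) (rz_card rzA).
- move=> x; rewrite -mulAB => /mulsgP[a b /(rz_nf rzA)[w wP ->] bB ->].
  by exists w => //; exists b.
- by [].
- by rewrite size_cat !size_map szpow szpow'.
- by rewrite size_cat size_map size_mkseq szconj.
- move=> j ltj /=; have [ltjn|lenj] := ltnP j n.
    by rewrite nth_cat_lt ?size_map ?szconj // (nth_map [::]) ?szconj // size_map szrow.
  have ltjm : (j - n < m)%N by lia.
  rewrite -(subnKC lenj) nth_cat_add ?size_map // nth_mkseq //.
  by rewrite size_cat size_nseq size_map szrow'.
- move=> k ltk; exists (nseq m 0%N); split=> //.
    by rewrite /pc_pow_rhs nth_cat_lt ?size_map ?szpow // (nth_map [::]) ?szpow.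
  by rewrite expo_prod0 mulg1 (rz_pow rzA).
- move=> k ltk; rewrite /pc_pow_rhs nth_cat_add ?size_map //.
  by rewrite (nth_map [::]) ?szpow'.
- move=> i j ltij ltj; exists (nseq m 0%N); split=> //.
    rewrite /pc_conj_rhs nth_cat_lt ?size_map ?szconj // (nth_map [::]) ?szconj //.
    by rewrite (nth_map [::]) ?szrow.
  by rewrite expo_prod0 mulg1 (rz_conj rzA).
- move=> i j lti ltj; exists (unit_word m j); split.
  + rewrite conjQE ?ltn_addr // nth_cat_lt ?size_nseq // nth_nseq lti.
    exact: unit_wordD.
  + apply/all2_ltnP; rewrite size_unit_word; split=> // l ltl.
    rewrite nth_unit_word //; apply: leq_ltn_trans (leq_b1 _) _.
    exact: (all_nthP 0%N oQ_gt1).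
  rewrite -[m](rz_size rzB) expo_prod_unit; apply/conjg_fixP/commgP.
  have tB : nth 1 t j \in B by apply/(rz_sub rzB)/mem_nth; rewrite (rz_size rzB).
  have sA : nth 1 s i \in A by apply/(rz_sub rzA)/mem_nth; rewrite (rz_size rzA).
  exact: (centsP cAB).
- move=> i j ltij ltj; rewrite conjQE ?ltn_add2l // nth_cat_add ?size_nseq //.
  by rewrite (nth_map [::]) ?szrow'.
Qed.

End Product.

Lemma ord_can_abelian_gt1 es : all (ltn 1%N) (pc_ord (can_abelian es)).
Proof.
elim: es => //= e es IHes; rewrite all_cat IHes andbT all_rev.
apply/allP=> p /flattenP[s /mapP[[q k] qk ->]] /nseqP[-> _].
by apply: prime_gt1; have [] := mem_prime_decomp qk.
Qed.

Lemma realizes_can_abelian (gT : finGroupType) (A : {group gT}) (b : seq gT) :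
  \big[dprod/1]_(x <- b) <[x]> = A ->
  exists s, realizes (can_abelian [seq #[x] | x <- b]) A s.
Proof.
elim: b A => [|x b IHb] A /=.
  by rewrite big_nil => /esym->; exists [::]; apply: realizes_empty.
rewrite big_cons => defA; have [[_ B _ defB] _ _ _] := dprodP defA.
have [t rzB] := IHb B defB; rewrite defB in defA.
exists (power_chain x (prime_list #[x]) ++ t).
apply: realizes_prod (realizes_cyclic x) rzB _ defA.
exact: ord_can_abelian_gt1.
Qed.

(** An elementary abelian group is presented as a product of copies of the cyclic
    group of order [p]. *)
Lemma pcp_elem_abelian p m : prime p -> pcp_elem p m = can_abelian (nseq m p).
Proof.
move=> p_pr; have cycE : can_cyclic p = Pcp [:: p] [:: [:: 0%N]] [:: [::]].
  have listE : prime_list p = [:: p].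
    by rewrite /prime_list prime_decompE primes_prime //= logn_prime // eqxx.
  by rewrite /can_cyclic listE.
elim: m => [|m IHm] //=; rewrite -IHm cycE /pcp_prod /pcp_elem /=.
rewrite /pc_rank /= size_nseq !map_nseq /=; congr Pcp.
rewrite /unit_conj.
apply: (@eq_from_nth _ [::]) => [|j]; rewrite size_mkseq ?[RHS]/= ?size_mkseq //.
case: j => [|j] ltj; rewrite nth_mkseq // [RHS]/= nth_mkseq // nth_mkseq //.
by rewrite map_nseq /= -unit_wordS.
Qed.

Lemma realizes_pcp_elem (gT : finGroupType) (A : {group gT}) p m :
  prime p -> p.-abelem A -> #|A| = (p ^ m)%N -> exists s, realizes (pcp_elem p m) A s.
Proof.
move=> p_pr abelA cardA; rewrite pcp_elem_abelian //.
have [b defA ordb] := abelian_structure (abelem_abelian abelA).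
have <- : [seq #[x] | x <- b] = nseq m p.
  rewrite ordb (abelian_type_abelem abelA) (rank_abelem abelA) cardA.
  by rewrite pfactorK.
exact: realizes_can_abelian defA.
Qed.

(** * The presentation of the extension defined by a cocycle *)

Lemma nth_map_enum_ord (T : Type) (x0 : T) n (F : 'I_n -> T) (k : 'I_n) :
  nth x0 [seq F i | i <- enum 'I_n] k = F k.
Proof. by rewrite (nth_map k) ?size_enum_ord // nth_ord_enum. Qed.

Lemma size_map_enum_ord (T : Type) n (F : 'I_n -> T) :
  size [seq F i | i <- enum 'I_n] = n.
Proof. by rewrite size_map size_enum_ord. Qed.

Lemma val_enum_ord_lt n j : (j <= n)%N ->
  map (@nat_of_ord n) [seq i : 'I_n <- enum 'I_n | (i < j)%N] = iota 0 j.
Proof.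
move=> lejn; rewrite -(filter_map (@nat_of_ord n) (fun i => i < j)%N).
rewrite val_enum_ord -(subnKC lejn) iotaD filter_cat add0n.
rewrite (all_filterP _); last by apply/allP=> i; rewrite mem_iota.
rewrite (eq_in_filter (a2 := pred0)) ?filter_pred0 ?cats0 // => i.
by rewrite mem_iota => /andP[leji _]; rewrite ltnNge leji.
Qed.

Section FilteredEnum.
Variables (n j : nat) (T : Type) (F : 'I_n -> T).
Hypothesis lejn : (j <= n)%N.

Lemma size_map_enum_ord_lt : size [seq F i | i : 'I_n <- enum 'I_n & (i < j)%N] = j.
Proof. by rewrite size_map -(size_map (@nat_of_ord n)) val_enum_ord_lt ?size_iota. Qed.

Lemma nth_map_enum_ord_lt (x0 : T) (i : 'I_n) : (i < j)%N ->
  nth x0 [seq F i | i : 'I_n <- enum 'I_n & (i < j)%N] i = F i.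
Proof.
have := size_map_enum_ord_lt; rewrite size_map; set s := filter _ _ => szs ltij.
rewrite (nth_map i) ?szs //; congr F; apply: ord_inj.
by rewrite -(nth_map i 0%N) ?szs // val_enum_ord_lt // nth_iota.
Qed.

End FilteredEnum.

Section ExtGroup.
Variables (H M : finGroupType) (z : cocycle H M).

Lemma ext_mulE (x y : ext z) :
  x * y = ext_pair z (x.1 * y.1) (coc_eps z y.1 x.2 * y.2 * coc_val z (x.1, y.1)).
Proof. by []. Qed.

Lemma coc_val1l h : coc_val z (1, h) = 1.
Proof. by have [/(_ h)[]] := coc_cocycle z. Qed.

Lemma coc_val1r h : coc_val z (h, 1) = 1.
Proof. by have [/(_ h)[]] := coc_cocycle z. Qed.

Lemma ext_inM : {in [set: M] &, {morph ext_pair z 1 : a b / a * b}}.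
Proof.
by move=> a b _ _; rewrite ext_mulE /= coc_eps1 coc_val1l mulg1 mulg1.
Qed.

Definition ext_in := Morphism ext_inM.

Lemma ext_mul_in h a b : ext_pair z h a * ext_pair z 1 b = ext_pair z h (a * b).
Proof. by rewrite ext_mulE /= coc_eps1 coc_val1r !mulg1. Qed.

(** Conjugation by [(h, 1)] on the kernel is the module action of [h]. *)
Lemma ext_conj_in h a : ext_pair z 1 a ^ ext_pair z h 1 = ext_pair z 1 (coc_eps z h a).
Proof.
apply: (mulgI (ext_pair z h 1)); rewrite -conjgC ext_mul_in mul1g.
by rewrite ext_mulE /= coc_val1l !mulg1 mul1g.
Qed.

Lemma ext_fstM : {in [set: ext z] &, {morph (fun x : ext z => x.1 : H) : x y / x * y}}.
Proof. by []. Qed.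

Lemma injm_ext_in : 'injm ext_in.
Proof. by apply/injmP=> a b _ _ []. Qed.

End ExtGroup.

Section ExtPresentation.
Variables (H M : cpcp) (p m : nat) (z : cocycle (pcg H) (pcg M)).
Hypotheses (p_pr : prime p) (defM : cpcp_val M = pcp_elem p m).
Variables (t1 : 'I_(pc_rank H) -> pcg M) (t2 : 'I_(pc_rank H) -> 'I_(pc_rank H) -> pcg M).
Hypothesis tailP : is_tail z t1 t2.
Let n := pc_rank H.

(** The generators are the pairs [(g_i, 1)] and [(1, a_j)].  The former satisfy the
    relations of [H] up to elements of [M], which are the tails by definition. *)
Lemma realizes_ext : exists s, realizes (ext_pcp z t1 t2) [set: ext z] s.
Proof.
have rzH := realizes_pcg H; have rzM := realizes_pcg M.
have rkM : pc_rank M = m by rewrite defM /pc_rank size_nseq.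
have [szpow powP szconj szrow conjP] := rz_pcp rzH.
pose s : seq (ext z) := [seq ext_pair z h 1 | h <- pc_gens H].
pose t : seq (ext z) := map (ext_in z) (pc_gens M).
have szs : size s = n by rewrite size_map size_pc_gens.
have sE (i : 'I_n) : nth 1 s i = ext_pair z (pc_gen i) 1.
  by rewrite (nth_map 1) ?size_pc_gens // nth_pc_gens.
have tE (i : 'I_(pc_rank M)) : nth 1 t i = ext_pair z 1 (pc_gen i).
  by rewrite (nth_map 1) ?size_pc_gens // nth_pc_gens.
have evalE w : size w = n -> ext_eval z w = expo_prod s w.
  by move=> szw; rewrite (expo_prodE szs szw); apply: eq_bigr => i _; rewrite sE.
have inE (a : pcg M) : ext_pair z 1 a = expo_prod t (expo_seq a).
  rewrite {1}(expo_seqE a) /t.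
  exact: (morph_expo_prod _ (@ext_inM _ _ z) (fun x _ => in_setT x)).
have s_fst w : (expo_prod s w).1 = expo_prod (pc_gens H) w :> pcg H.
  rewrite (morph_expo_prod _ (@ext_fstM _ _ z) (fun x _ => in_setT x)).
  by rewrite -map_comp map_id.
exists (s ++ t); pose N := (ext_in z @* [set: pcg M])%G.
apply: (realizes_extension (P := H) (Q := M) (N := N)) => //; rewrite -/n ?rkM.
- by move=> x _; rewrite in_setT.
- exact: subsetT.
- by apply: realizes_morphim rzM; apply: injm_ext_in.
- rewrite /= card_injm ?injm_ext_in // -(rz_card rzH) !cardsT.
  exact: card_prod.
- case=> h a _; have /(rz_nf rzH)[w wP hE] := in_setT h; exists w => //.
  exists (ext_pair z 1 ((expo_prod s w).2^-1 * a)).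
    exact: (mem_morphim (ext_in z) (in_setT _) (in_setT _)).
  have -> : expo_prod s w = ext_pair z h (expo_prod s w).2.
    by rewrite {1}hE -s_fst; case: (expo_prod s w).
  by rewrite ext_mul_in mulKVg.
- by rewrite size_cat size_map_enum_ord size_nseq rkM.
- by rewrite size_cat 2!size_map_enum_ord rkM.
- move=> j ltj /=; have [ltjn|lenj] := ltnP j n.
    rewrite nth_cat_lt ?size_map_enum_ord //.
    rewrite (nth_map_enum_ord _ _ (Ordinal ltjn)).
    by rewrite size_map_enum_ord_lt // ltnW.
  have ltjm : (j - n < pc_rank M)%N by rewrite rkM; lia.
  rewrite -(subnKC lenj) nth_cat_add ?size_map_enum_ord //.
  rewrite (nth_map_enum_ord _ _ (Ordinal ltjm)).
  by rewrite size_cat size_nseq size_map_enum_ord.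
- move=> k ltk; exists (expo_seq (t1 (Ordinal ltk))); split.
  + rewrite /pc_pow_rhs nth_cat_lt ?size_map_enum_ord //.
    exact: (nth_map_enum_ord _ _ (Ordinal ltk)).
  + exact: expo_seq_lt.
  + have [/(_ (Ordinal ltk)) tail_k _] := tailP; have [szk _] := powP k ltk.
    by rewrite (sE (Ordinal ltk)) -inE -evalE.
- move=> k ltk; rewrite /pc_pow_rhs nth_cat_add ?size_map_enum_ord //.
  by rewrite rkM defM /= !nth_nseq ltk nseqD.
- move=> i j ltij ltj; have lti := ltn_trans ltij ltj.
  exists (expo_seq (t2 (Ordinal lti) (Ordinal ltj))); split.
  + rewrite /pc_conj_rhs nth_cat_lt ?size_map_enum_ord //.
    rewrite (nth_map_enum_ord _ _ (Ordinal ltj)).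
    by rewrite (@nth_map_enum_ord_lt _ _ _ _ _ _ (Ordinal lti)) // ltnW.
  + exact: expo_seq_lt.
  + have [_ /(_ (Ordinal lti) (Ordinal ltj) ltij) tail_ij] := tailP.
    have [szij _] := conjP i j ltij ltj.
    by rewrite (sE (Ordinal lti)) (sE (Ordinal ltj)) -inE -evalE.
- move=> i j lti ltj; have ltjM : (j < pc_rank M)%N by rewrite rkM.
  exists (expo_seq (coc_eps z (pc_gen (Ordinal lti)) (pc_gen (Ordinal ltjM)))); split.
  + rewrite /pc_conj_rhs nth_cat_add ?size_map_enum_ord //.
    rewrite (nth_map_enum_ord _ _ (Ordinal ltjM)).
    rewrite nth_cat_lt ?size_map_enum_ord //.
    exact: (nth_map_enum_ord _ _ (Ordinal lti)).
  + exact: expo_seq_lt.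
  + by rewrite (sE (Ordinal lti)) (tE (Ordinal ltjM)) -inE ext_conj_in.
- move=> i j ltij ltj; have ltjM : (j < pc_rank M)%N by rewrite rkM.
  rewrite /pc_conj_rhs nth_cat_add ?size_map_enum_ord //.
  rewrite (nth_map_enum_ord _ _ (Ordinal ltjM)).
  rewrite nth_cat_add ?size_map_enum_ord // nth_nseq ltij.
  have -> : nth [::] (nth [::] (pc_conj M) j) i = unit_word m j.
    by rewrite defM nth_mkseq // nth_nseq ltij.
  by rewrite unit_wordD -rkM.
Qed.

End ExtPresentation.

(** * Module structures and cocycles of a normal section *)

(** A homomorphism of [A] onto a whole type with kernel [N], as a function on the
    ambient type.  It encodes an isomorphism from [A / N]; composing with
    automorphisms, restricting and transporting it need no quotient types. *)
Record epi_with_kernel (gT hT : finGroupType) (A N : {set gT}) (f : gT -> hT) : Prop := {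
  epiM : {in A &, {morph f : x y / x * y}};
  epi_onto : forall y, exists2 x, x \in A & f x = y;
  epi_ker : forall x, x \in A -> (f x == 1) = (x \in N) }.

Lemma coset_eq1 (gT : finGroupType) (N : {group gT}) x :
  x \in 'N(N) -> (coset N x == 1) = (x \in N).
Proof. by move=> nNx; apply/eqP/idP => [/coset_idr->|/coset_id]. Qed.

Section Epi.
Variables (gT hT : finGroupType) (A N : {group gT}) (f : gT -> hT).
Hypothesis epf : epi_with_kernel A N f.

Lemma epi1 : f 1 = 1.
Proof. exact: (morph1 (Morphism (epiM epf))). Qed.

Lemma epiV x : x \in A -> f x^-1 = (f x)^-1.
Proof. exact: (morphV (Morphism (epiM epf))). Qed.

Lemma epi_eq x y : x \in A -> y \in A -> (f x == f y) = (x^-1 * y \in N).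
Proof.
move=> xA yA; rewrite -(epi_ker epf) ?groupM ?groupV //.
by rewrite (epiM epf) ?groupV // epiV // eq_mulVg1.
Qed.

Lemma epi_aut u : u \in Aut [set: hT] -> epi_with_kernel A N (fun x => u (f x)).
Proof.
move=> uA; have uM : {morph u : x y / x * y}.
  by move=> x y; rewrite (morphicP (Aut_morphic uA)) ?inE.
have u1 : u 1 = 1 by apply: (mulgI (u 1)); rewrite -uM !mulg1.
split=> [x y xA yA|y|x xA].
- by rewrite (epiM epf).
- by have [x xA fx] := epi_onto epf (u^-1 y); exists x; rewrite // fx permKV.
- by rewrite -{1}u1 (inj_eq perm_inj) (epi_ker epf).
Qed.

(** [f] and [g] identify the same elements of [A], so [g x] is a function of
    [f x]. *)
Lemma epi_aut_unique (g : gT -> hT) : epi_with_kernel A N g ->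
  exists2 u, u \in Aut [set: hT] & {in A, forall x, g x = u (f x)}.
Proof.
move=> epg.
pose lift y := sval (cid2 (epi_onto epf y)).
have liftP y : lift y \in A /\ f (lift y) = y by rewrite /lift; case: cid2.
have gE x : x \in A -> g x = g (lift (f x)).
  move=> xA; have [lA fl] := liftP (f x); apply/eqP.
  have gEf a b : a \in A -> b \in A -> (g a == g b) = (f a == f b).
    move=> aA bA; rewrite (epi_eq aA bA) -(epi_ker epg) ?groupM ?groupV //.
    rewrite (epiM epg) ?groupV // eq_mulVg1; congr (_ * _ == _).
    by rewrite -[g a^-1]/(Morphism (epiM epg) _) morphV.
  by rewrite gEf // fl.
have inj : injective (fun y => g (lift y)).
  move=> y y' /eqP; have [lA fl] := liftP y; have [lA' fl'] := liftP y'.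
  move=> glE; rewrite -fl -fl'; apply/eqP; rewrite epi_eq // -(epi_ker epg) ?groupM ?groupV //.
  rewrite (epiM epg) ?groupV //; rewrite eq_mulVg1 in glE.
  by rewrite -[g _^-1]/(Morphism (epiM epg) _) morphV.
exists (perm inj) => [|x xA]; last by rewrite permE -gE.
rewrite inE; apply/andP; split; first by apply/subsetP=> x _; rewrite inE.
apply/morphicP=> y y' _ _; rewrite !permE.
have [lA fl] := liftP y; have [lA' fl'] := liftP y'.
by rewrite -(epiM epg) // -{1}fl -{1}fl' -(epiM epf) // -gE ?groupM.
Qed.

Hypothesis nNA : N <| A.

Lemma epi_isom : exists2 phi : {morphism A / N >-> hT},
  isom (A / N) [set: hT] phi & {in A, forall x, phi (coset N x) = f x}.
Proof.
have nNx x : x \in A -> x \in 'N(N) by apply/subsetP/normal_norm.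
have fE x y : x \in A -> y \in A -> (coset N x == coset N y) = (f x == f y).
  move=> xA yA; rewrite epi_eq // -coset_eq1 ?groupM ?groupV ?nNx //.
  by rewrite morphM ?groupV ?nNx // morphV ?nNx // eq_mulVg1.
pose phi c := f (odflt 1 [pick x in A | coset N x == c]).
have phiE x : x \in A -> phi (coset N x) = f x.
  move=> xA; rewrite /phi; case: pickP => [y /andP[yA]|/(_ x)].
    by rewrite fE //= => /eqP.
  by rewrite xA eqxx.
have phiM : {in A / N &, {morph phi : x y / x * y}}.
  move=> _ _ /morphimP[x nx xA ->] /morphimP[y ny yA ->].
  by rewrite -(morphM (coset_morphism N)) ?phiE ?groupM // (epiM epf).
exists (Morphism phiM); last exact: phiE.
apply/isomP; split.
  apply/injmP=> _ _ /morphimP[x nx xA ->] /morphimP[y ny yA ->] /=.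
  by rewrite !phiE // => /eqP; rewrite -fE // => /eqP.
apply/setP=> y; rewrite inE; have [x xA <-] := epi_onto epf y; rewrite -phiE //.
by apply: (mem_morphim (Morphism phiM)) => //; apply: mem_quotient.
Qed.

End Epi.

Lemma isom_epi (gT hT : finGroupType) (A N : {group gT}) (phi : {morphism A / N >-> hT}) :
  N <| A -> isom (A / N) [set: hT] phi ->
  epi_with_kernel A N (fun x => phi (coset N x)).
Proof.
move=> nNA /isomP[inj im].
have nNx x : x \in A -> x \in 'N(N) by apply/subsetP/normal_norm.
split=> [x y xA yA|y|x xA].
- by rewrite morphM ?nNx // morphM ?mem_quotient.
- have : y \in phi @* (A / N) by rewrite im.
  by case/morphimP=> _ _ /morphimP[x _ xA ->] ->; exists x.
- by rewrite morph_injm_eq1 ?mem_quotient // coset_eq1 ?nNx.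
Qed.

Lemma epi_transport (gT rT hT : finGroupType) (G A N : {group gT}) (A' N' : {group rT})
    (f : {morphism G >-> rT}) (a : rT -> hT) :
  'injm f -> A \subset G -> N \subset G -> f @* A = A' -> f @* N = N' ->
  epi_with_kernel A' N' a -> epi_with_kernel A N (fun x => a (f x)).
Proof.
move=> injf sAG sNG fA fN epa.
have fxA x : x \in A -> f x \in A'.
  by move=> xA; rewrite -fA mem_morphim ?(subsetP sAG).
split=> [x y xA yA|y|x xA].
- by rewrite morphM ?(subsetP sAG) // (epiM epa) ?fxA.
- have [x'] := epi_onto epa y; rewrite -fA => /morphimP[x _ xA ->] <-.
  by exists x.
- rewrite (epi_ker epa) ?fxA // -fN; apply/idP/idP=> [/morphimP[y yG yN fxy]|xN].
    by have -> : x = y by apply: (injmP injf) fxy => //; apply: (subsetP sAG).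
  by rewrite mem_morphim ?(subsetP sAG).
Qed.

Section Datum.
Variables (gT H M : finGroupType) (G K L : {set gT}).

(** Isomorphisms from [G / K] to [H] and from [K / L] to [M] with the induced module
    structure, expressed on the elements of [G]; only the values of [b] on [K]
    matter. *)
Record ext_datum (a : gT -> H) (b : gT -> M) (eps : {ffun H -> {perm M}}) : Prop := {
  dat_top : epi_with_kernel G K a;
  dat_bot : epi_with_kernel K L b;
  dat_act : forall g x, g \in G -> x \in K -> eps (a g) (b x) = b (x ^ g) }.

(** A transversal of [K] in [G]; its normalisation holds modulo [L], which is all
    that a section from [G / K] to [G / L] provides. *)
Definition is_lift (a : gT -> H) (b : gT -> M) (s : H -> gT) : Prop :=
  (forall h, s h \in G /\ a (s h) = h) /\ b (s 1) = 1.

Definition lift_cocycle (b : gT -> M) (s : H -> gT) : {ffun H * H -> M} :=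
  [ffun gh => b ((s (gh.1 * gh.2))^-1 * (s gh.1 * s gh.2))].

Definition modstr_of (eps : {ffun H -> {perm M}}) : Prop :=
  exists a b, ext_datum a b eps.

Definition cocycle_of (eps : {ffun H -> {perm M}}) (c : {ffun H * H -> M}) : Prop :=
  exists a b s, [/\ ext_datum a b eps, is_lift a b s & c = lift_cocycle b s].

End Datum.

Lemma Aut_morph (hT : finGroupType) (u : {perm hT}) :
  u \in Aut [set: hT] -> {morph u : x y / x * y}.
Proof. by move=> uA x y; rewrite (morphicP (Aut_morphic uA)) ?inE. Qed.

Section DatumTheory.
Variables (gT H M : finGroupType) (G K L : {group gT}).
Hypotheses (nKG : K <| G) (nLG : L <| G) (sLK : L \subset K).
Hypothesis abM : abelian [set: M].

Let mulMC (x y : M) : x * y = y * x.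
Proof. by apply: (centsP abM); rewrite inE. Qed.

Let sKG : K \subset G := normal_sub nKG.

Let conjK x g : x \in K -> g \in G -> x ^ g \in K.
Proof. by move=> xK gG; rewrite memJ_norm // (subsetP (normal_norm nKG)). Qed.

(** The action of [a g] is conjugation by [g]. *)
Lemma modstr_of_is_modstr eps : modstr_of G K L eps -> @is_modstr H M eps.
Proof.
case=> a [b [epa epb act]]; split=> [h|g h].
  have [g gG <-] := epi_onto epa h.
  rewrite inE; apply/andP; split; first by apply/subsetP=> x _; rewrite inE.
  apply/morphicP=> y y' _ _.
  have [x xK <-] := epi_onto epb y; have [x' xK' <-] := epi_onto epb y'.
  by rewrite -(epiM epb) // !act ?groupM // conjMg (epiM epb) ?conjK.
apply/permP=> y; rewrite permM.
have [g0 gG <-] := epi_onto epa g; have [h0 hG <-] := epi_onto epa h.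
have [x xK <-] := epi_onto epb y.
by rewrite -(epiM epa) // !act ?conjK ?groupM // conjgM.
Qed.

(** The value [b (x ^ g)] depends only on [a g] and [b x]: changing [x] by an
    element of [L] changes [x ^ g] by one, as [L] is normal in [G]; changing [g] by an
    element of [K] changes [x] by an inner automorphism of [K], invisible in the
    abelian group [M]. *)
Lemma modstr_of_exists (a : gT -> H) (b : gT -> M) :
  epi_with_kernel G K a -> epi_with_kernel K L b -> exists eps, ext_datum G K L a b eps.
Proof.
move=> epa epb.
pose la h := sval (cid2 (epi_onto epa h)); pose lb y := sval (cid2 (epi_onto epb y)).
have laP h : la h \in G /\ a (la h) = h by rewrite /la; case: cid2.
have lbP y : lb y \in K /\ b (lb y) = y by rewrite /lb; case: cid2.
have bJ x x' g : x \in K -> x' \in K -> g \in G -> b x = b x' -> b (x ^ g) = b (x' ^ g).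
  move=> xK xK' gG /eqP; rewrite (epi_eq epb) // => xL.
  apply/eqP; rewrite (epi_eq epb) ?conjK // -conjVg -conjMg.
  by rewrite memJ_norm // (subsetP (normal_norm nLG)).
have bJK x k : x \in K -> k \in K -> b (x ^ k) = b x.
  by move=> xK kK; rewrite conjgE !(epiM epb) ?groupM ?groupV // (epiV epb) // mulMC mulgK.
have bJa x g g' : x \in K -> g \in G -> g' \in G -> a g = a g' -> b (x ^ g) = b (x ^ g').
  move=> xK gG gG' /eqP; rewrite (epi_eq epa) // => kK.
  by rewrite -(mulKVg g g') conjgM [RHS]bJK ?conjK.
pose e h y := b (lb y ^ la h).
have eE g x : g \in G -> x \in K -> e (a g) (b x) = b (x ^ g).
  move=> gG xK; have [gG' agg] := laP (a g); have [xK' bxx] := lbP (b x).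
  by rewrite /e (bJ _ x) //; apply: bJa.
have e_inj h : injective (e h).
  have [g gG <-] := epi_onto epa h.
  have eK : cancel (e (a g)) (e (a g^-1)).
    move=> y; have [x xK <-] := epi_onto epb y.
    by rewrite !eE ?groupV ?conjK // conjgK.
  exact: can_inj eK.
exists [ffun h => perm (e_inj h)]; split=> // g x gG xK.
by rewrite ffunE permE eE.
Qed.

Section OneDatum.
Variables (a : gT -> H) (b : gT -> M) (eps : {ffun H -> {perm M}}).
Hypothesis dat : ext_datum G K L a b eps.
Let epa := dat_top dat.
Let epb := dat_bot dat.
Let act := dat_act dat.

Lemma lift_exists : exists s, is_lift G a b s.
Proof.
pose s h := if h == 1 then 1 else sval (cid2 (epi_onto epa h)).
exists s; split; last by rewrite /s eqxx (epi1 epb).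
move=> h; rewrite /s; case: eqP => [->|_]; first by rewrite (epi1 epa).
by case: cid2.
Qed.

Lemma is_lift_factor s g h : is_lift G a b s -> (s (g * h))^-1 * (s g * s h) \in K.
Proof.
case=> sP _; have [sgG ag] := sP g; have [shG ah] := sP h; have [sghG agh] := sP (g * h).
rewrite -(epi_ker epa) ?groupM ?groupV //.
by rewrite !(epiM epa) ?groupM ?groupV // (epiV epa) // agh ag ah mulVg.
Qed.

Lemma is_lift1 s : is_lift G a b s -> s 1 \in K.
Proof. by case=> /(_ 1)[sG a1] _; rewrite -(epi_ker epa) // a1. Qed.

(** Both sides of the cocycle identity are the image of
    [(s (g h k))^-1 s g s h s k]. *)
Lemma lift_cocycle_cocycle s : is_lift G a b s -> is_cocycle eps (lift_cocycle b s).
Proof.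
move=> lift_s; have [sP s1] := lift_s; have sK := is_lift_factor _ _ lift_s.
have s1K := is_lift1 lift_s.
split=> [h|g h k].
  have [shG ah] := sP h.
  split; rewrite ffunE /=.
    by rewrite mul1g -conjgE -(act shG s1K) s1 -(epi1 epb) act ?conj1g.
  by rewrite mulg1 mulKg.
rewrite !ffunE /=; have [skG ak] := sP k.
set x := _ * (s g * s h); have xK : x \in K by apply: sK.
have -> : eps k (b x) = b (x ^ s k) by rewrite -act // ak.
rewrite -!(epiM epb) ?conjK //; congr (b _).
by rewrite conjgE /x !mulgA !mulgK.
Qed.

(** The two lifts differ by the map [k] into the kernel. *)
Lemma lift_cocycle_change s s' : is_lift G a b s -> is_lift G a b s' ->
  lift_cocycle b s' = [ffun gh => lift_cocycle b s gh *
                         coboundary eps [ffun h => b ((s h)^-1 * s' h)] gh].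
Proof.
move=> lift_s lift_s'; have [sP s1] := lift_s; have [sP' s1'] := lift_s'.
pose k h := (s h)^-1 * s' h.
have kK h : k h \in K.
  have [sG ah] := sP h; have [sG' ah'] := sP' h.
  rewrite -(epi_ker epa) ?groupM ?groupV // (epiM epa) ?groupV // (epiV epa) //.
  by rewrite ah ah' mulVg.
apply/ffunP=> -[g h]; rewrite !ffunE /=.
have [shG ah] := sP h; have cK := is_lift_factor g h lift_s.
rewrite -!/(k _).
have -> : eps h (b (k g)) = b (k g ^ s h) by rewrite -act // ah.
set c := _ * (s g * s h) in cK *.
have -> : (s' (g * h))^-1 * (s' g * s' h) = (k (g * h))^-1 * c * (k g ^ s h * k h).
  by rewrite /c /k conjgE !invMg !invgK !mulgA !mulgK.
have kJ : k g ^ s h \in K by apply: conjK.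
have kV : (k (g * h))^-1 \in K by rewrite groupV.
rewrite (epiM epb) ?(groupM kV cK) ?(groupM kJ) //.
rewrite (epiM epb kV cK) (epiM epb kJ (kK h)) (epiV epb) //.
by rewrite (mulMC _ (b c)) !mulgA.
Qed.

(** Multiplying a lift by representatives of the values of [f] adds the coboundary
    of [f] to its cocycle. *)
Lemma lift_coboundary s (f : {ffun H -> M}) : is_lift G a b s -> f 1 = 1 ->
  exists2 s', is_lift G a b s' &
    lift_cocycle b s' = [ffun gh => lift_cocycle b s gh * coboundary eps f gh].
Proof.
move=> lift_s f1; have [sP s1] := lift_s.
pose k h := sval (cid2 (epi_onto epb (f h))).
have kP h : k h \in K /\ b (k h) = f h by rewrite /k; case: cid2.
have lift_sk : is_lift G a b (fun h => s h * k h).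
  split=> [h|]; last first.
    by have [kK bk] := kP 1; rewrite (epiM epb) ?(is_lift1 lift_s) // s1 bk f1 mulg1.
  have [sG ah] := sP h; have [kK _] := kP h; have kG := subsetP sKG _ kK.
  rewrite groupM // (epiM epa) // ah; split=> //.
  have /eqP-> : a (k h) == 1 by rewrite (epi_ker epa).
  by rewrite mulg1.
exists (fun h => s h * k h) => //; rewrite (lift_cocycle_change lift_s lift_sk).
rewrite (_ : [ffun _ => _] = f) //; apply/ffunP=> h.
by rewrite ffunE mulKg (kP h).2.
Qed.

(** Composing with automorphisms moves the module structure along its orbit. *)
Lemma modstr_act_dat (u : {perm H}) (v : {perm M}) : u \in Aut [set: H] -> v \in Aut [set: M] ->
  ext_datum G K L (fun g => u (a g)) (fun x => v (b x)) (modstr_act u v eps).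
Proof.
move=> uA vA; split; [exact: epi_aut|exact: epi_aut|move=> g x gG xK].
by rewrite ffunE !permM !permK act.
Qed.

Lemma lift_act s (u : {perm H}) (v : {perm M}) :
    u \in Aut [set: H] -> v \in Aut [set: M] -> is_lift G a b s ->
  is_lift G (fun g => u (a g)) (fun x => v (b x)) (fun h => s (u^-1 h)).
Proof.
move=> uA vA [sP s1]; split=> [h|].
  by have [sG ah] := sP (u^-1 h); rewrite ah permKV.
have aut1 (T : finGroupType) (w : {perm T}) : w \in Aut [set: T] -> w 1 = 1.
  by move=> /Aut_morph wM; apply: (mulgI (w 1)); rewrite -wM !mulg1.
by rewrite aut1 ?groupV // s1 aut1.
Qed.

Lemma lift_cocycle_act s (u : {perm H}) (v : {perm M}) : u \in Aut [set: H] ->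
  lift_cocycle (fun x => v (b x)) (fun h => s (u^-1 h)) = cocycle_act u v (lift_cocycle b s).
Proof.
move=> uA; apply/ffunP=> -[g h]; rewrite !ffunE /=.
by rewrite Aut_morph ?groupV.
Qed.

(** Another choice of the two isomorphisms differs by a pair of automorphisms. *)
Lemma dat_unique a' b' eps' : ext_datum G K L a' b' eps' ->
  exists uv, [/\ is_aut_pair uv, {in G, forall g, a' g = uv.1 (a g)},
    {in K, forall x, b' x = uv.2 (b x)} & eps' = modstr_act uv.1 uv.2 eps].
Proof.
case=> epa' epb' act'; have [u uA aE] := epi_aut_unique epa epa'.
have [v vA bE] := epi_aut_unique epb epb'.
exists (u, v); split=> //; apply/ffunP=> h; apply/permP=> y.
have [g gG <-] := epi_onto epa' h; have [x xK <-] := epi_onto epb' y.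
by rewrite act' // !ffunE !permM aE // !bE ?conjK // !permK act.
Qed.

(** The orbit does not depend on the module structure one starts from. *)
Lemma modstr_orbitE eps' : modstr_orbit eps eps' <-> modstr_of G K L eps'.
Proof.
split=> [[[u v] [/= uA vA] ->]|[a' [b' /dat_unique[uv [autuv _ _ ->]]]]].
  by exists (fun g => u (a g)), (fun x => v (b x)); apply: modstr_act_dat.
by exists uv.
Qed.

(** Compatible pairs form the stabiliser of the module structure. *)
Lemma compatible_pairE uv : is_aut_pair uv ->
  compatible_pair eps uv <-> modstr_act uv.1 uv.2 eps = eps.
Proof.
case: uv => u v autuv; split=> [[_ comp]|epsE].
  apply/ffunP=> h; apply/permP=> y.
  by rewrite ffunE !permM comp !permKV.
split=> // h y; have /ffunP/(_ (u h))/permP/(_ (v y)) := epsE.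
by rewrite /= ffunE !permM !permK.
Qed.

(** The elements of [G] are [s h * x] with [x] in [K]; sending such an element
    to [(h, b x)] turns the product of [G] into that of the extension. *)
Lemma ext_epi (z : cocycle H M) s : coc_eps z = eps -> is_lift G a b s ->
  coc_val z = lift_cocycle b s ->
  epi_with_kernel G L (fun g => ext_pair z (a g) (b ((s (a g))^-1 * g))).
Proof.
move=> epsE lift_s valE; have [sP s1] := lift_s.
have s1K := is_lift1 lift_s.
have rK g : g \in G -> (s (a g))^-1 * g \in K.
  move=> gG; have [sG ah] := sP (a g).
  by rewrite -(epi_ker epa) ?groupM ?groupV // (epiM epa) ?groupV // (epiV epa) // ah mulVg.
split=> [g h gG hG|[h y]|g gG].
- rewrite ext_mulE /= epsE valE ffunE /= (epiM epa) //; congr (ext_pair z _ _).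
  have cK := is_lift_factor (a g) (a h) lift_s.
  have gJ := conjK (rK g gG) hG.
  have sgK : s (a h) \in G by have [] := sP (a h).
  have -> : eps (a h) (b ((s (a g))^-1 * g)) = b (((s (a g))^-1 * g) ^ s (a h)).
    by rewrite -act ?rK // (sP _).2.
  have gJs := conjK (rK g gG) sgK.
  rewrite mulMC -!(epiM epb) ?(groupM gJs) ?rK //.
  by congr (b _); rewrite conjgE !mulgA !mulgK.
- have [sG ah] := sP h; have [x xK bx] := epi_onto epb y.
  have xG := subsetP sKG _ xK; exists (s h * x); first by rewrite groupM.
  have -> : a (s h * x) = h.
    by rewrite (epiM epa) // ah; have /eqP-> : a x == 1; rewrite ?(epi_ker epa) ?mulg1.
  by rewrite mulKg bx.
- rewrite -[1]/(ext_pair z 1 1) -[LHS]/((a g == 1) && (b _ == 1)).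
  case: eqP => [ag|/eqP ag] /=.
    have gK : g \in K by rewrite -(epi_ker epa) // ag.
    by rewrite ag (epiM epb) ?groupV // (epiV epb) // s1 invg1 mul1g (epi_ker epb).
  by apply/esym/negbTE; apply: contra ag => /(subsetP sLK); rewrite (epi_ker epa).
Qed.

End OneDatum.

(** The union of classes is the set of all cocycles of the extension [G / L] of
    [G / K] by [K / L] that induce the action [eps]: it does not depend on the
    cocycle one starts from. *)
Lemma cocycle_classE (a : gT -> H) (b : gT -> M) eps s c :
  ext_datum G K L a b eps -> is_lift G a b s ->
  cocycle_class eps (lift_cocycle b s) c <-> cocycle_of G K L eps c.
Proof.
move=> dat lift_s; split.
  case=> -[u v] [_ [comp [f f1 ->] ->]] /=; have [autuv _] := comp.
  have [/= uA vA] := autuv.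
  have dat' := modstr_act_dat dat uA vA.
  have epsE := (compatible_pairE eps autuv).1 comp; rewrite /= in epsE.
  rewrite epsE in dat'.
  have [s' lift_s' sE] := lift_coboundary dat' (lift_act uA vA lift_s) f1.
  exists (fun g => u (a g)), (fun x => v (b x)), s'; split=> //.
  by rewrite sE lift_cocycle_act.
case=> a' [b' [s' [dat' lift_s' ->]]].
have [[u v] [autuv aE bE epsE]] := dat_unique dat dat'; have [uA vA] := autuv.
have comp : compatible_pair eps (u, v) by apply/compatible_pairE.
have lift_s1 : is_lift G a' b' (fun h => s (u^-1 h)).
  have lift_s1 := lift_act uA vA lift_s; have [sP s1] := lift_s1; split=> [h|].
    by have [sG ah] := sP h; rewrite aE.
  by rewrite bE // (is_lift1 (modstr_act_dat dat uA vA) lift_s1).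
rewrite (lift_cocycle_change dat' lift_s1 lift_s').
set f := [ffun h => b' _].
exists (u, v), (coboundary eps f); split=> //.
  exists f; rewrite // ffunE.
  have sK1 := is_lift1 dat' lift_s1; have [_ s11] := lift_s1; have [_ s1'] := lift_s'.
  rewrite (epiM (dat_bot dat')) ?groupV ?(is_lift1 dat' lift_s') //.
  by rewrite (epiV (dat_bot dat')) // s11 s1' mulg1 invg1.
apply/ffunP=> gh; rewrite ffunE [RHS]ffunE; congr (_ * _).
have cK := is_lift_factor dat' gh.1 gh.2 lift_s1.
by rewrite -lift_cocycle_act // !ffunE bE.
Qed.

End DatumTheory.

(** * Least elements *)

Lemma minimum_exists (T : finType) (r : rel T) (D S : T -> Prop) :
  total_order_on D r -> (forall x, S x -> D x) -> (exists x, S x) ->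
  exists x, is_minimum r S x.
Proof.
case=> rxx _ rtrans rtot SD [x0 Sx0].
suff [x Sx minx] : exists2 x, S x & forall y, y \in enum T -> S y -> r x y.
  by exists x; split=> // y; apply: minx; rewrite mem_enum.
elim: (enum T) => [|z s [x Sx minx]]; first by exists x0.
have [Sz|nSz] := pselect (S z); last first.
  by exists x => // y; rewrite inE => /predU1P[->|/minx].
case/orP: (rtot x z (SD _ Sx) (SD _ Sz)) => [rxz|rzx].
  by exists x => // y; rewrite inE => /predU1P[->|/minx].
exists z => // y; rewrite inE => /predU1P[->|ys] Sy; first exact: rxx (SD _ Sz).
exact: rtrans (SD _ Sz) (SD _ Sx) (SD _ Sy) rzx (minx y ys Sy).
Qed.

Lemma minimum_unique (T : Type) (r : rel T) (D S : T -> Prop) x y :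
  total_order_on D r -> (forall x, S x -> D x) ->
  is_minimum r S x -> is_minimum r S y -> x = y.
Proof.
move=> ord SD [Sx minx] [Sy miny].
by apply: (to_anti ord); [exact: SD|exact: SD|exact: minx|exact: miny].
Qed.

Lemma is_minimum_ext (T : Type) (r : rel T) (S S' : T -> Prop) x :
  (forall y, S y <-> S' y) -> is_minimum r S x -> is_minimum r S' x.
Proof. by move=> SS' [Sx minx]; split=> [|y /SS']; [apply/SS'|apply: minx]. Qed.

(** * Transport along isomorphisms *)

Section Transport.
Variables (gT rT H M : finGroupType) (G K L : {group gT}) (G' K' L' : {group rT}).
Variable f : {morphism G >-> rT}.
Hypotheses (injf : 'injm f) (fG : f @* G = G') (fK : f @* K = K') (fL : f @* L = L').
Hypotheses (sKG : K \subset G) (sLK : L \subset K).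

Lemma ext_datum_transport (a : rT -> H) (b : rT -> M) eps :
  ext_datum G' K' L' a b eps -> ext_datum G K L (fun x => a (f x)) (fun x => b (f x)) eps.
Proof.
case=> epa epb act; split.
- exact: epi_transport injf _ _ fG fK epa.
- exact: epi_transport injf _ (subset_trans sLK sKG) fK fL epb.
move=> g x gG xK; have xG := subsetP sKG _ xK.
by rewrite act ?morphJ // -?fG -?fK mem_morphim.
Qed.

Lemma modstr_of_transport (eps : {ffun H -> {perm M}}) :
  modstr_of G' K' L' eps -> modstr_of G K L eps.
Proof.
by case=> a [b dat]; do 2!eexists; apply: ext_datum_transport dat.
Qed.

Lemma cocycle_of_transport eps (c : {ffun H * H -> M}) :
  cocycle_of G' K' L' eps c -> cocycle_of G K L eps c.
Proof.
case=> a [b [s [dat [sP s1] ->]]].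
have sE h : exists2 g, g \in G & f g = s h.
  by have [] := sP h; rewrite -fG => /morphimP[g _ gG ->]; exists g.
pose s' h := sval (cid2 (sE h)).
have s'P h : s' h \in G /\ f (s' h) = s h by rewrite /s'; case: cid2.
exists (fun x => a (f x)), (fun x => b (f x)), s'; split.
- exact: ext_datum_transport dat.
- split=> [h|]; last by rewrite (s'P 1).2.
  by have [s'G ->] := s'P h; have [_ ->] := sP h.
apply/ffunP=> -[g h]; rewrite !ffunE /=.
have [s1G sg] := s'P g; have [s2G sh] := s'P h; have [s3G sgh] := s'P (g * h).
by rewrite !morphM ?groupM ?groupV // morphV // sg sh sgh.
Qed.

End Transport.

(** * One step of the construction *)

(** The outcome of one step, described without its auxiliary choices: the action
    and the cocycle are the least ones that the extension of [G / K] by [K / L]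
    admits. *)
Definition canonical_step (O : orderings) (gT : finGroupType) (G K L : {group gT})
    (H : cpcp) (P : pcp) : Prop :=
  exists p m (M : cpcp) (lambda : cocycle (pcg H) (pcg M)) t1 t2,
  [/\ prime p, #|K / L| = (p ^ m)%N, cpcp_val M = pcp_elem p m
    & [/\ is_minimum (ord_mod O H M) (modstr_of G K L) (coc_eps lambda),
          is_minimum (ord_map O H M) (cocycle_of G K L (coc_eps lambda)) (coc_val lambda),
          is_tail lambda t1 t2 & P = ext_pcp lambda t1 t2]].

Section Step.
Variables (O : orderings) (gT : finGroupType) (G K L : {group gT}).
Hypotheses (nKG : K <| G) (nLG : L <| G) (sLK : L \subset K).

Let sKG : K \subset G := normal_sub nKG.
Let nLK : L <| K := normalS sLK sKG nLG.

(** By [modstr_orbitE] and [cocycle_classE] the two minima are taken over the same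
    sets.  From left to right, the data come from the isomorphisms and the section
    of the step.  From right to left, the least cocycle is itself induced by some
    datum and lift; taking these as the choices of the step, the cocycle to be
    minimised is already the least one. *)
Lemma can_step_canonical H P : can_step O G K L H P <-> canonical_step O G K L H P.
Proof.
have nKx x : x \in G -> x \in 'N(K) by apply/subsetP/normal_norm.
have nLx x : x \in G -> x \in 'N(L) by apply/subsetP/normal_norm.
split.
  case=> p m M phi beta tau gamma lambda t1 t2 p_pr cardKL defM isophi isobeta epsE mineps.
  case=> tau1 tauP gammaE mingamma tailP.
  have [injphi imphi] := isomP isophi.
  pose a g := phi (coset K g); pose b x := beta (coset L x).
  have abM := coc_abelian lambda.
  have dat : ext_datum G K L a b (coc_eps lambda).
    by split=> //; apply: isom_epi.
  have sE h : exists g, [/\ g \in G, a g = h & coset L g = tau (coset K g)].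
    have [g gG <-] := epi_onto (dat_top dat) h.
    have [g' gG' [eg etau]] := tauP _ (mem_quotient K gG).
    by exists g'; rewrite /a eg etau.
  pose s h := sval (cid (sE h)).
  have sP h : [/\ s h \in G, a (s h) = h & coset L (s h) = tau (coset K (s h))].
    by rewrite /s; case: cid.
  have aK g g' : g \in G -> g' \in G -> a g = a g' -> coset K g = coset K g'.
    by move=> gG gG'; apply: (injmP injphi); apply: mem_quotient.
  have lift_s : is_lift G a b s.
    split=> [h|]; first by have [sG ah _] := sP h.
    have [sG ah st] := sP 1; rewrite /b st (aK _ 1) ?ah // /a.
      by rewrite coset_id // tau1 morph1.
    by rewrite coset_id // morph1.
  have gamE : gamma = lift_cocycle b s.
    apply/ffunP=> -[g h]; rewrite ffunE /=.
    have [s1G a1 e1] := sP g; have [s2G a2 e2] := sP h; have [s3G a3 e3] := sP (g * h).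
    rewrite -{1}a1 -{1}a2 gammaE ?mem_quotient //.
    have cosM : {in G &, {morph coset L : x y / x * y}}.
      by move=> x y xG yG; rewrite morphM ?nLx.
    have cosV x : x \in G -> coset L x^-1 = (coset L x)^-1.
      by move=> xG; exact: (morphV (coset_morphism L) (nLx x xG)).
    rewrite /b cosM ?groupM ?groupV // cosM // cosV // e1 e2 e3.
    have -> // : coset K (s g) * coset K (s h) = coset K (s (g * h)).
    rewrite -morphM ?nKx //; apply: aK; rewrite ?groupM //.
    by rewrite a3 (epiM (dat_top dat)) // a1 a2.
  exists p, m, M, lambda, t1, t2; split=> //; split=> //.
    exact: is_minimum_ext (modstr_orbitE nKG dat) mineps.
  apply: is_minimum_ext mingamma => c; rewrite gamE.
  exact: cocycle_classE dat lift_s.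
case=> p [m [M [lambda [t1 [t2 [p_pr cardKL defM [mineps minc tailP ->]]]]]]].
have [[a [b [s [dat lift_s cE]]]] _] := minc.
have abM := coc_abelian lambda.
have [phi isophi phiE] := epi_isom (dat_top dat) nKG.
have [beta isobeta betaE] := epi_isom (dat_bot dat) nLK.
have [sP s1] := lift_s.
pose tau c := coset L (s (phi c)).
have tauE g : g \in G -> tau (coset K g) = coset L (s (a g)).
  by move=> gG; rewrite /tau phiE.
have [injphi _] := isomP isophi.
apply: (@CanStep O gT G K L H p m M phi beta tau (coc_val lambda)) => //.
- by move=> g x gG xK; rewrite phiE // !betaE ?(dat_act dat) // memJ_norm ?nKx.
- exact: is_minimum_ext (fun e => iff_sym (modstr_orbitE nKG dat e)) mineps.
- split=> [|_ /morphimP[g ng gG ->]].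
    rewrite /tau morph1 coset_id // -(epi_ker (dat_bot dat)) ?s1 //.
    by have s1K := is_lift1 dat lift_s.
  have [sG ah] := sP (a g); exists (s (a g)); rewrite // tauE //; split=> //.
  by apply: (injmP injphi); rewrite ?mem_quotient // !phiE.
- move=> _ _ /morphimP[g ng gG ->] /morphimP[h nh hG ->].
  rewrite -morphM ?nKx // !phiE ?tauE ?groupM //.
  have [s1G a1] := sP (a g); have [s2G a2] := sP (a h); have [s3G a3] := sP (a (g * h)).
  have cosM : {in G &, {morph coset L : x y / x * y}}.
    by move=> x y xG yG; rewrite morphM ?nLx.
    have cosV x : x \in G -> coset L x^-1 = (coset L x)^-1.
      by move=> xG; exact: (morphV (coset_morphism L) (nLx x xG)).
  rewrite -cosM // -cosV // -cosM ?groupM ?groupV //.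
  have aM := epiM (dat_top dat) gG hG.
  rewrite aM betaE; last by have := is_lift_factor dat (a g) (a h) lift_s.
  by rewrite cE ffunE.
- rewrite {1}cE; apply: is_minimum_ext minc => c; apply: iff_sym.
  exact: cocycle_classE dat lift_s.
Qed.

(** The least cocycle is induced by a lift, so [ext_epi] identifies its extension
    with [G / L]. *)
Lemma canonical_step_realizes H P : canonical_step O G K L H P ->
  exists s, realizes P (G / L) s.
Proof.
case=> p [m [M [lambda [t1 [t2 [p_pr _ defM [_ [minc _] tailP ->]]]]]]].
have [a [b [s [dat lift_s cE]]]] := minc.
have abM := coc_abelian lambda.
have epe := ext_epi nKG sLK abM dat (erefl _) lift_s cE.
have [phi isophi _] := epi_isom epe nLG.
have [t rzE] := realizes_ext p_pr defM tailP.
have /isogP[g injg img] : [set: ext lambda] \isog G / L.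
  by rewrite isog_sym; apply: isom_isog isophi.
by exists (map g t); rewrite -img; apply: realizes_morphim.
Qed.

(** The two sides of a relation of [H], evaluated at the pairs [(g_i, 1)], have the
    same first component. *)
Lemma tail_exists (H M : cpcp) (z : cocycle (pcg H) (pcg M)) :
  exists t1 t2, is_tail z t1 t2.
Proof.
have factor (x y : ext z) : x.1 = y.1 -> exists t, x = y * ext_pair z 1 t.
  case: x y => [h a] [_ b] /= <-; exists (b^-1 * a).
  by rewrite (ext_mul_in z h b) mulKVg.
have fstM : {in [set: ext z] &, {morph (fun x : ext z => x.1) : x y / x * y}} by [].
pose fst_ext := Morphism fstM.
have fst_eval w : size w = pc_rank H -> (ext_eval z w).1 = expo_prod (pc_gens H) w.
  move=> szw; rewrite -[LHS]/(fst_ext _) morph_prod => [|i _]; last by rewrite inE.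
  rewrite (expo_prodE (size_pc_gens H) szw); apply: eq_bigr => i _.
  by rewrite morphX ?inE // nth_pc_gens.
have rzH := realizes_pcg H; have [_ powP _ _ conjP] := rz_pcp rzH.
have t1P k : exists t, ext_pair z (pc_gen k) 1 ^+ pc_relord H k =
             ext_eval z (pc_pow_rhs H k) * ext_pair z 1 t.
  apply: factor; have [szk _] := powP k (ltn_ord k).
  rewrite fst_eval // -(rz_pow rzH) // nth_pc_gens.
  by rewrite -[LHS]/(fst_ext _) morphX ?inE.
have t2P (i j : 'I_(pc_rank H)) : exists t, (i < j)%N ->
     ext_pair z (pc_gen j) 1 ^ ext_pair z (pc_gen i) 1 =
     ext_eval z (pc_conj_rhs H i j) * ext_pair z 1 t.
  case: ltnP => [ltij|_]; last by exists 1.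
  have [szij _] := conjP i j ltij (ltn_ord j).
  have [|t tE] := factor (ext_pair z (pc_gen j) 1 ^ ext_pair z (pc_gen i) 1)
                    (ext_eval z (pc_conj_rhs H i j)); last by exists t.
  rewrite fst_eval // -(rz_conj rzH) // !nth_pc_gens.
  by rewrite -[LHS]/(fst_ext _) morphJ ?inE.
exists (fun k => sval (cid (t1P k))), (fun i j => sval (cid (t2P i j))).
by split=> [k|i j ltij]; case: cid => //= t; apply.
Qed.

Lemma canonical_step_exists (H : cpcp) p : prime p -> p.-abelem (K / L) ->
  G / K \isog [set: pcg H] -> exists P, canonical_step O G K L H P.
Proof.
move=> p_pr abelKL /isog_isom[phi isophi].
have epa := isom_epi nKG isophi.
have cardKL : #|K / L| = (p ^ logn p #|K / L|)%N by apply: card_pgroup; apply: abelem_pgroup abelKL.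
have [t rzM] := realizes_pcp_elem p_pr abelKL cardKL.
have [M defM isoM] := realizes_cpcp rzM.
have abM : abelian [set: pcg M] by rewrite (isog_abelian isoM) (abelem_abelian abelKL).
have /isog_isom[beta isobeta] : K / L \isog [set: pcg M] by rewrite isog_sym.
have epb := isom_epi nLK isobeta.
have [eps0 dat0] := modstr_of_exists nKG nLG abM epa epb.
have [eps mineps] : exists eps, is_minimum (ord_mod O H M) (modstr_of G K L) eps.
  apply: minimum_exists (ord_modP O H M) _ _.
    exact: modstr_of_is_modstr.
  by exists eps0; do 2!eexists; apply: dat0.
have [[a [b dat]] _] := mineps; have [s lift_s] := lift_exists dat.
have [c minc] : exists c, is_minimum (ord_map O H M) (cocycle_of G K L eps) c.
  apply: minimum_exists (ord_mapP O H M) _ _ => //.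
  by exists (lift_cocycle b s), a, b, s.
have cocc : is_cocycle eps c.
  have [[a' [b' [s' [dat' lift_s' ->]]]] _] := minc.
  exact: lift_cocycle_cocycle dat' _ lift_s'.
pose lambda := Cocycle abM (modstr_of_is_modstr nKG mineps.1) cocc.
have [t1 [t2 tailP]] := tail_exists lambda.
exists (ext_pcp lambda t1 t2); exists p, (logn p #|K / L|), M, lambda, t1, t2.
by split.
Qed.

End Step.

(** For the trivial group the prime is not determined, but the presentation is
    empty. *)
Lemma pcp_elem_inj_card p q m n : prime p -> prime q -> (p ^ m = q ^ n)%N ->
  pcp_elem p m = pcp_elem q n.
Proof.
move=> p_pr q_pr eq_pq; case: m n eq_pq => [|m] [|n] // eq_pq.
- by have := ltn_expl n.+1 (prime_gt1 q_pr); rewrite -eq_pq.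
- by have := ltn_expl m.+1 (prime_gt1 p_pr); rewrite eq_pq.
have pq : p = q.
  have: (p %| q ^ n.+1)%N by rewrite -eq_pq dvdn_exp.
  by rewrite Euclid_dvdX // andbT dvdn_prime2 // => /eqP.
by move: eq_pq; rewrite pq => /eqP; rewrite eqn_exp2l ?prime_gt1 // => /eqP->.
Qed.

(** The remaining fields are proofs. *)
Lemma cocycle_inj (H M : finGroupType) (z z' : cocycle H M) :
  coc_eps z = coc_eps z' -> coc_val z = coc_val z' -> z = z'.
Proof.
case: z z' => [ab e me c cc] [ab' e' me' c' cc'] /= ee' cc0.
subst e' c'.
by rewrite (Prop_irrelevance ab ab') (Prop_irrelevance me me') (Prop_irrelevance cc cc').
Qed.

Lemma tail_unique (H M : cpcp) (z : cocycle (pcg H) (pcg M)) t1 t2 t1' t2' :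
  is_tail z t1 t2 -> is_tail z t1' t2' -> ext_pcp z t1 t2 = ext_pcp z t1' t2'.
Proof.
case=> pow conj [pow' conj'].
have ext_inj x (a b : pcg M) : x * ext_pair z 1 a = x * ext_pair z 1 b -> a = b.
  by move/mulgI => [].
have e1 k : t1 k = t1' k by apply: (ext_inj (ext_eval z (pc_pow_rhs H k))); rewrite -pow -pow'.
have e2 (i j : 'I_(pc_rank H)) : (i < j)%N -> t2 i j = t2' i j.
  by move=> ltij; apply: (ext_inj (ext_eval z (pc_conj_rhs H i j))); rewrite -conj // -conj'.
rewrite /ext_pcp; congr (Pcp _ (_ ++ _) (_ ++ _)).
  by apply: eq_map => k; rewrite e1.
apply: eq_map => j; apply/eq_in_map => i; rewrite mem_filter => /andP[ltij _].
by rewrite e2.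
Qed.

(** The sets in which the module structure and the cocycle are least elements are
    carried along [f] and its inverse, hence equal for the two groups. *)
Lemma canonical_step_unique (O : orderings) (gT rT : finGroupType)
    (G K L : {group gT}) (G' K' L' : {group rT}) (f : {morphism G >-> rT}) H P Q :
    'injm f -> f @* G = G' -> f @* K = K' -> f @* L = L' ->
    K <| G -> L <| G -> L \subset K ->
  canonical_step O G K L H P -> canonical_step O G' K' L' H Q -> P = Q.
Proof.
move=> injf fG fK fL nKG nLG sLK.
have sKG := normal_sub nKG; have sLG := normal_sub nLG.
have sKG' : K' \subset G' by rewrite -fK -fG morphimS.
have sLK' : L' \subset K' by rewrite -fK -fL morphimS.
have injg : 'injm (invm injf) by apply: injm_invm.
have invE (A : {group gT}) (A' : {group rT}) : A \subset G -> f @* A = A' -> invm injf @* A' = A.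
  by move=> sAG <-; apply: morphim_invm.
have [gG gK gL] := And3 (invE _ _ (subxx G) fG) (invE _ _ sKG fK) (invE _ _ sLG fL).
have defG' : G' = (f @* G)%G by apply: val_inj; rewrite /= fG.
have modstrE (M : cpcp) (eps : {ffun pcg H -> {perm pcg M}}) :
    modstr_of G K L eps <-> modstr_of G' K' L' eps.
  split; last first.
    exact: (@modstr_of_transport _ _ (pcg H) (pcg M) _ _ _ _ _ _ _ injf fG fK fL sKG sLK).
  rewrite defG' in gG sKG' *.
  exact: (@modstr_of_transport _ _ (pcg H) (pcg M) _ _ _ _ _ _ _ injg gG gK gL sKG' sLK').
have cocycleE (M : cpcp) eps (c : {ffun pcg H * pcg H -> pcg M}) :
    cocycle_of G K L eps c <-> cocycle_of G' K' L' eps c.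
  split; last first.
    exact: (@cocycle_of_transport _ _ (pcg H) (pcg M) _ _ _ _ _ _ _ injf fG fK fL sKG sLK).
  rewrite defG' in gG sKG' *.
  exact: (@cocycle_of_transport _ _ (pcg H) (pcg M) _ _ _ _ _ _ _ injg gG gK gL sKG' sLK').
have card_quo : #|K / L| = #|K' / L'|.
  have nLK : K \subset 'N(L) by apply: subset_trans sKG (normal_norm nLG).
  have nLK' : K' \subset 'N(L') by rewrite -fK -fL morphim_norms.
  by rewrite !card_quotient // -!divgS // -fK -fL !card_injm.
case=> p [m [M [z [t1 [t2 [p_pr cardKL defM [mineps minc tailP ->]]]]]]].
case=> q [n [M' [z' [t1' [t2' [q_pr cardKL' defM' [mineps' minc' tailP' ->]]]]]]].
have defMM : M = M'.
  apply: cpcp_inj; rewrite defM defM'; apply: pcp_elem_inj_card => //.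
  by rewrite -cardKL -cardKL'.
subst M'; have abM := coc_abelian z.
have eq_eps : coc_eps z = coc_eps z'.
  apply: (minimum_unique (ord_modP O H M)) (mineps) _.
    exact: modstr_of_is_modstr.
  by apply: is_minimum_ext mineps' => eps; apply: iff_sym.
have eq_val : coc_val z = coc_val z'.
  apply: (minimum_unique (ord_mapP O H M)) (minc) _ => //.
  by rewrite eq_eps; apply: is_minimum_ext minc' => c; apply: iff_sym (cocycleE _ _ c).
rewrite (cocycle_inj eq_eps eq_val) in tailP *.
exact: tail_unique.
Qed.

(** * The whole construction *)

Lemma isom_quotient (gT rT : finGroupType) (G K : {group gT}) (G' K' : {group rT})
    (f : {morphism G >-> rT}) :
  'injm f -> f @* G = G' -> f @* K = K' -> K <| G -> G / K \isog G' / K'.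
Proof.
move=> injf fG fK nKG; have -> : K' = (f @* K)%G by apply: val_inj; rewrite /= fK.
rewrite -fG; apply/isogP; exists (quotm_morphism f nKG); first exact: injm_quotm.
by rewrite morphim_quotm.
Qed.

Section Filtration.
Variables (C : canonical_filtration) (gT : finGroupType) (G : {group gT}).
Hypothesis solG : solvable G.
Let c := cf_len C G.
Let term := cf_term C G.

(** Automorphisms of [G] preserve the terms of a canonical filtration. *)
Lemma cf_char i : (1 <= i <= c.+1)%N -> term i \char G.
Proof.
move=> /andP[i_gt0 leic]; apply/charP; split=> [|f injf fG].
  elim: i i_gt0 leic => // -[|i] IHi _ leic; first by rewrite /term cf_first.
  apply: subset_trans (IHi _ _) => //; last exact: ltnW.
  by apply: normal_sub; apply: cf_normal.
have isof : isom G G f by apply/isomP.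
by have [_ ->] := cf_isom C solG isof; rewrite // i_gt0.
Qed.

Lemma cf_normal_top i : (1 <= i <= c.+1)%N -> term i <| G.
Proof. by move/cf_char/char_normal. Qed.

Lemma cf_len_gt0 : G :!=: 1 -> (0 < c)%N.
Proof.
rewrite lt0n; apply: contra => /eqP c0; rewrite -(cf_first C solG).
by have := cf_last C solG; rewrite -/c c0 => ->.
Qed.

End Filtration.

Section Canonical.
Variables (C : canonical_filtration) (I : abelian_invariants) (O : orderings).
Hypothesis abC : abelian_top C.

Section OneGroup.
Variables (gT : finGroupType) (G : {group gT}).
Hypotheses (solG : solvable G) (ntG : G :!=: 1).
Let c := cf_len C G.
Let term := cf_term C G.

Lemma can_base_realizes : exists s, realizes (can_abelian (ai_inv I (G / term 2))) (G / term 2) s.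
Proof.
have [b defQ <-] := ai_cyclic I (abC solG).
exact: realizes_can_abelian defQ.
Qed.

Lemma step_hyps k : (2 <= k <= c)%N ->
  [/\ term k <| G, term k.+1 <| G & term k.+1 \subset term k].
Proof.
case/andP=> k_gt1 lekc; split.
- by apply: cf_normal_top; rewrite // (ltnW k_gt1) ltnW.
- by apply: cf_normal_top.
- by apply: normal_sub; apply: cf_normal; rewrite // (ltnW k_gt1).
Qed.

Lemma can_quotient_realizes k P : is_can_quotient C I O G k P ->
  exists s, realizes P (G / term k) s.
Proof.
case=> [|{}k H {}P lekc _ stepP]; first exact: can_base_realizes.
have [nK nL sLK] := step_hyps lekc.
by have := canonical_step_realizes nK nL sLK ((can_step_canonical O nK nL sLK _ _).1 stepP).
Qed.

Lemma can_quotient_exists k : (2 <= k <= c.+1)%N ->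
  exists P, is_can_quotient C I O G k P.
Proof.
case/andP; elim: k => // k IHk; rewrite leq_eqVlt => /predU1P[<- _|k_gt1 lekc].
  by eexists; apply: can_quotient_base.
have [P canP] := IHk k_gt1 (ltnW lekc); have [s rzP] := can_quotient_realizes canP.
have [H HP isoH] := realizes_cpcp rzP; rewrite isog_sym in isoH.
have lekc' : (2 <= k <= c)%N by apply/andP.
have [nK nL sLK] := step_hyps lekc'.
have [p p_pr abel] := cf_abelem solG lekc'.
have [Q stepQ] := canonical_step_exists O nK nL sLK p_pr abel isoH.
exists Q; apply: can_quotient_step lekc' _ ((can_step_canonical O nK nL sLK H Q).2 stepQ).
by rewrite HP.
Qed.

End OneGroup.

Lemma can_exists (gT : finGroupType) (G : {group gT}) :
  solvable G -> exists P, is_can C I O G P.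
Proof.
move=> solG; rewrite /is_can; case: eqVneq => [_|ntG]; first by exists pcp_empty.
by apply: can_quotient_exists => //; rewrite !ltnS cf_len_gt0 /=.
Qed.

(** The last quotient is [G] modulo the trivial group. *)
Lemma can_realizes (gT : finGroupType) (G : {group gT}) P :
  solvable G -> is_can C I O G P -> exists s, realizes P G s.
Proof.
move=> solG; rewrite /is_can; case: eqVneq => [-> ->|ntG canP].
  by exists [::]; apply: realizes_empty.
have := can_quotient_realizes solG canP; rewrite cf_last // => -[s rzP].
have /isogP[f injf <-] : G / 1 \isog G by rewrite isog_sym; apply: quotient1_isog.
by exists (map f s); apply: realizes_morphim.
Qed.

Lemma can_quotient_inv (gT : finGroupType) (G : {group gT}) k P :
  is_can_quotient C I O G k P ->
  k = 2 /\ P = can_abelian (ai_inv I (G / cf_term C G 2)) \/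
  exists j (K : cpcp), [/\ k = j.+1, (2 <= j <= cf_len C G)%N,
    is_can_quotient C I O G j K & can_step O G (cf_term C G j) (cf_term C G j.+1) K P].
Proof. by case=> [|j K {}P]; [left | right; exists j, K]. Qed.

Section TwoGroups.
Variables (gT hT : finGroupType) (G : {group gT}) (H : {group hT}).
Variable f : {morphism G >-> hT}.
Hypotheses (solG : solvable G) (solH : solvable H) (ntG : G :!=: 1) (isof : isom G H f).

(** An isomorphism respects the filtrations, so it also identifies the sets from
    which the steps select least elements. *)
Lemma can_quotient_unique k P Q : is_can_quotient C I O G k P ->
  is_can_quotient C I O H k Q -> P = Q.
Proof.
have [len_eq termE] := cf_isom C solG isof; have [injf fG] := isomP isof.
move=> canP; elim: canP Q => [|{}k K {}P lekc _ IHk stepP] Q /can_quotient_inv.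
  case=> [[_ ->]|[j [K [[<-] /andP[]]]]] //.
  have le2c : (1 <= 2 <= (cf_len C G).+1)%N by exact: cf_len_gt0.
  congr can_abelian; apply: (ai_isog I (abC solG)).
  by apply: isom_quotient injf fG _ (cf_normal_top solG le2c); apply: termE.
case=> [[[k1] _]|[j [K' [[<-] lekc' canK' stepQ]]]]; first by rewrite k1 in lekc.
have KK' : K = K' by apply: cpcp_inj; apply: IHk.
rewrite -{K' canK'}KK' in stepQ.
have [nK nL sLK] := step_hyps solG lekc.
have [nK' nL' sLK'] := step_hyps solH lekc'.
have [/andP[k_gt1 lek] /andP[_ lek']] := conj lekc lekc'.
apply: canonical_step_unique injf fG _ _ nK nL sLK
  ((can_step_canonical O nK nL sLK _ _).1 stepP)
  ((can_step_canonical O nK' nL' sLK' _ _).1 stepQ).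
- by apply: termE; rewrite (ltnW k_gt1) ltnW.
- by apply: termE.
Qed.

Lemma can_unique P Q : is_can C I O G P -> is_can C I O H Q -> P = Q.
Proof.
have isoGH := isom_isog f (subxx G) isof.
rewrite /is_can (negPf ntG) -(isog_eq1 isoGH) (negPf ntG).
have [<- _] := cf_isom C solG isof; exact: can_quotient_unique.
Qed.

End TwoGroups.
End Canonical.

Theorem theorem3p13 (C : canonical_filtration) (abC : abelian_top C)
    (I : abelian_invariants) (O : orderings)
    (gT hT : finGroupType) (G : {group gT}) (H : {group hT})
    (solG : solvable G) (solH : solvable H) :
  (exists P, is_can C I O G P) /\ (exists Q, is_can C I O H Q) /\
  (forall P Q : pcp, is_can C I O G P -> is_can C I O H Q ->
     (G \isog H <-> P = Q)).
Proof.
split; [exact: can_exists | split; first exact: can_exists].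
move=> P Q canP canQ; split=> [isoGH|eqPQ].
  have [G1|ntG] := eqVneq (G : {set gT}) 1.
    have H1 : H :==: 1 by rewrite -(isog_eq1 isoGH) G1.
    by move: canP canQ; rewrite /is_can H1 G1 eqxx => -> ->.
  have [f isof] := isog_isom isoGH.
  exact: can_unique isof P Q canP canQ.
have [s rzG] := can_realizes abC solG canP; have [t rzH] := can_realizes abC solH canQ.
by rewrite -eqPQ in rzH; apply: realizes_unique rzG rzH.
Qed.
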